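(* Let $\mathbb{F}$ be a subfield of $\mathbb{C}$ closed under complex conjugation with $\mathbb{A}\cap\mathbb{R}\subseteq\mathbb{F}\subseteq\mathbb{C}$, and let $\mathsf{QL}(\mathcal N)=\bigcap_{d<\omega}\mathsf{QL}(\mathsf L(\mathbb{C}^d))$. Then: (1) $\mathsf{QL}(\mathcal N)=\bigcap_{d<\omega}\mathsf{QL}(\mathsf L(\mathbb{F}^d))$; (2) $\mathsf{QL}(\mathcal N)=\mathsf{QL}(L)$ for every ortholattice $L$ which is the direct limit of a direct system of ortholattices $\mathsf L(\mathbb{F}^{d_n})$, $n<\omega$, with ortholattice embeddings as connecting maps and $d_n\to\infty$; (3) $\mathsf{QL}(\mathcal N)=\mathsf{QL}(CG(\mathbb{F}))$.
   Context: $\mathbb{A}$ denotes the field of algebraic complex numbers. For a conjugation-closed subfield $\mathbb{F}\subseteq\mathbb{C}$, $\mathbb{F}^d$ carries the canonical inner product $\langle x,y\rangle=\sum_i x_i\overline{y_i}$, and $\mathsf L(\mathbb{F}^d)$ is the ortholattice of all linear subspaces of $\mathbb{F}^d$ with intersection, sum, and orthogonal complement $X\mapsto X^\perp$; it is a modular ortholattice. For a class (or single member) $\mathcal C$ of ortholattices, $\mathsf{QL}(\mathcal C)$ denotes the set of ortholattice identities (in $\vee,\wedge,{}',0,1$) valid in all members of $\mathcal C$. $CG(\mathbb{F})$ is von Neumann's continuous geometry over $\mathbb{F}$: take the direct system $\mathsf L(\mathbb{F}^{2^n})$ with the ortholattice embeddings $X\mapsto X\oplus X\subseteq \mathbb{F}^{2^n}\oplus\mathbb{F}^{2^n}=\mathbb{F}^{2^{n+1}}$,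 let $L_\infty$ be its direct limit equipped with the metric $\delta(X,Y)=2^{-n}(\dim(X+Y)-\dim(X\cap Y))$ for $X,Y\in\mathsf L(\mathbb{F}^{2^n})$ (compatible with the embeddings), and let $CG(\mathbb{F})$ be the metric completion of $L_\infty$ with the operations extended by continuity. *)

(* Defs.v *)
From Stdlib Require Import Reals List Arith ClassicalEpsilon.
Open Scope R_scope.

Record Cx := mkC { re : R; im : R }.
Definition C0 : Cx := mkC 0 0.
Definition C1 : Cx := mkC 1 0.
Definition RtoC (x : R) : Cx := mkC x 0.
Definition Cadd (a b : Cx) : Cx := mkC (re a + re b) (im a + im b).
Definition Copp (a : Cx) : Cx := mkC (- re a) (- im a).
Definition Cmul (a b : Cx) : Cx :=
  mkC (re a * re b - im a * im b) (re a * im b + im a * re b).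
Definition Cconj (a : Cx) : Cx := mkC (re a) (- im a).
Definition Cinv (a : Cx) : Cx :=
  mkC (re a / (re a * re a + im a * im a)) (- im a / (re a * re a + im a * im a)).

Fixpoint poly_eval (p : list Z) (x : R) : R :=
  match p with nil => 0 | c :: p' => IZR c + x * poly_eval p' x end.
Definition real_algebraic (x : R) : Prop :=
  exists p : list Z, (exists c, In c p /\ c <> 0%Z) /\ poly_eval p x = 0.

Definition conj_closed_subfield (F : Cx -> Prop) : Prop :=
  F C0 /\ F C1 /\
  (forall a b, F a -> F b -> F (Cadd a b)) /\
  (forall a, F a -> F (Copp a)) /\
  (forall a b, F a -> F b -> F (Cmul a b)) /\
  (forall a, F a -> a <> C0 -> F (Cinv a)) /\
  (forall a, F a -> F (Cconj a)).
Definition contains_real_algebraics (F : Cx -> Prop) : Prop :=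
  forall x, real_algebraic x -> F (RtoC x).

(* Vectors of F^d are represented as nat -> Cx with coordinates in F below d
   and zero from d on. *)
Definition vec := nat -> Cx.
Definition vzero : vec := fun _ => C0.
Definition vadd (v w : vec) : vec := fun i => Cadd (v i) (w i).
Definition vscale (c : Cx) (v : vec) : vec := fun i => Cmul c (v i).
Definition inF (F : Cx -> Prop) (d : nat) (v : vec) : Prop :=
  (forall i, (i < d)%nat -> F (v i)) /\ (forall i, (d <= i)%nat -> v i = C0).
Fixpoint Csum (d : nat) (f : nat -> Cx) : Cx :=
  match d with O => C0 | S d' => Cadd (Csum d' f) (f d') end.
Definition inner (d : nat) (v w : vec) : Cx := Csum d (fun i => Cmul (v i) (Cconj (w i))).

Definition subspace (F : Cx -> Prop) (d : nat) (X : vec -> Prop) : Prop :=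
  (forall v, X v -> inF F d v) /\ X vzero /\
  (forall v w, X v -> X w -> X (vadd v w)) /\
  (forall c v, F c -> X v -> X (vscale c v)).

Definition sp_meet (X Y : vec -> Prop) : vec -> Prop := fun v => X v /\ Y v.
Definition sp_join (X Y : vec -> Prop) : vec -> Prop :=
  fun v => exists x y, X x /\ Y y /\ v = vadd x y.
Definition sp_orth (F : Cx -> Prop) (d : nat) (X : vec -> Prop) : vec -> Prop :=
  fun v => inF F d v /\ forall w, X w -> inner d v w = C0.
Definition sp_zero : vec -> Prop := fun v => v = vzero.
Definition sp_one (F : Cx -> Prop) (d : nat) : vec -> Prop := inF F d.

Inductive term : Type :=
| tVar : nat -> term
| tMeet : term -> term -> term
| tJoin : term -> term -> term
| tOrth : term -> term
| tZero : term
| tOne : term.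

Fixpoint eval_sp (F : Cx -> Prop) (d : nat) (s : nat -> vec -> Prop) (t : term)
  : vec -> Prop :=
  match t with
  | tVar i => s i
  | tMeet a b => sp_meet (eval_sp F d s a) (eval_sp F d s b)
  | tJoin a b => sp_join (eval_sp F d s a) (eval_sp F d s b)
  | tOrth a => sp_orth F d (eval_sp F d s a)
  | tZero => sp_zero
  | tOne => sp_one F d
  end.

Definition valid_LF (F : Cx -> Prop) (d : nat) (s t : term) : Prop :=
  forall sg : nat -> vec -> Prop, (forall i, subspace F d (sg i)) ->
    forall v, eval_sp F d sg s v <-> eval_sp F d sg t v.

Definition Call : Cx -> Prop := fun _ => True.

Definition QL_N (s t : term) : Prop := forall d, valid_LF Call d s t.

Record OL := {
  car :> Type;
  omeet : car -> car -> car;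
  ojoin : car -> car -> car;
  oorth : car -> car;
  obot : car;
  otop : car;
  meet_comm : forall x y, omeet x y = omeet y x;
  join_comm : forall x y, ojoin x y = ojoin y x;
  meet_assoc : forall x y z, omeet x (omeet y z) = omeet (omeet x y) z;
  join_assoc : forall x y z, ojoin x (ojoin y z) = ojoin (ojoin x y) z;
  absorb_mj : forall x y, omeet x (ojoin x y) = x;
  absorb_jm : forall x y, ojoin x (omeet x y) = x;
  bot_least : forall x, omeet obot x = obot;
  top_greatest : forall x, ojoin otop x = otop;
  orth_invol : forall x, oorth (oorth x) = x;
  orth_antitone : forall x y, omeet x y = x -> omeet (oorth y) (oorth x) = oorth y;
  orth_meet : forall x, omeet x (oorth x) = obot;
  orth_join : forall x, ojoin x (oorth x) = otop
}.

Fixpoint eval_OL (L : OL) (s : nat -> L) (t : term) : L :=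
  match t with
  | tVar i => s i
  | tMeet a b => omeet L (eval_OL L s a) (eval_OL L s b)
  | tJoin a b => ojoin L (eval_OL L s a) (eval_OL L s b)
  | tOrth a => oorth L (eval_OL L s a)
  | tZero => obot L
  | tOne => otop L
  end.

Definition valid_OL (L : OL) (s t : term) : Prop :=
  forall sg : nat -> L, eval_OL L sg s = eval_OL L sg t.

(* Elements of L(F^d) are the predicates X with subspace F d X; equality is
   Leibniz equality of predicates (extensional under propext/funext). *)
Definition OL_embedding_sp (F : Cx -> Prop) (d : nat) (L : OL)
  (g : (vec -> Prop) -> L) : Prop :=
  (forall X Y, subspace F d X -> subspace F d Y -> g (sp_meet X Y) = omeet L (g X) (g Y)) /\
  (forall X Y, subspace F d X -> subspace F d Y -> g (sp_join X Y) = ojoin L (g X) (g Y)) /\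
  (forall X, subspace F d X -> g (sp_orth F d X) = oorth L (g X)) /\
  g sp_zero = obot L /\ g (sp_one F d) = otop L /\
  (forall X Y, subspace F d X -> subspace F d Y -> g X = g Y -> X = Y).

Definition sp_embedding (F : Cx -> Prop) (d d' : nat)
  (f : (vec -> Prop) -> (vec -> Prop)) : Prop :=
  (forall X, subspace F d X -> subspace F d' (f X)) /\
  (forall X Y, subspace F d X -> subspace F d Y -> f (sp_meet X Y) = sp_meet (f X) (f Y)) /\
  (forall X Y, subspace F d X -> subspace F d Y -> f (sp_join X Y) = sp_join (f X) (f Y)) /\
  (forall X, subspace F d X -> f (sp_orth F d X) = sp_orth F d' (f X)) /\
  f sp_zero = sp_zero /\ f (sp_one F d) = sp_one F d' /\
  (forall X Y, subspace F d X -> subspace F d Y -> f X = f Y -> X = Y).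

Definition is_direct_limit (F : Cx -> Prop) (dn : nat -> nat)
  (f : nat -> (vec -> Prop) -> (vec -> Prop)) (L : OL)
  (g : nat -> (vec -> Prop) -> L) : Prop :=
  (forall n, OL_embedding_sp F (dn n) L (g n)) /\
  (forall n X, subspace F (dn n) X -> g (S n) (f n X) = g n X) /\
  (forall a : L, exists n X, subspace F (dn n) X /\ g n X = a).

Definition Linf := (nat * (vec -> Prop))%type.
Definition Linf_elem (F : Cx -> Prop) (a : Linf) : Prop := subspace F (2 ^ fst a) (snd a).

(* X |-> X ⊕ X ⊆ F^(2^n) ⊕ F^(2^n) = F^(2^(n+1)) *)
Definition dup (n : nat) (X : vec -> Prop) : vec -> Prop :=
  fun w => (forall i, (2 ^ S n <= i)%nat -> w i = C0) /\
           X (fun i => if Nat.ltb i (2 ^ n) then w i else C0) /\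
           X (fun i => if Nat.ltb i (2 ^ n) then w (2 ^ n + i)%nat else C0).
Fixpoint lift (n k : nat) (X : vec -> Prop) : vec -> Prop :=
  match k with O => X | S k' => dup (n + k') (lift n k' X) end.
Definition liftTo (a : Linf) (m : nat) : vec -> Prop := lift (fst a) (m - fst a) (snd a).

Definition Linf_meet (a b : Linf) : Linf :=
  let k := Nat.max (fst a) (fst b) in (k, sp_meet (liftTo a k) (liftTo b k)).
Definition Linf_join (a b : Linf) : Linf :=
  let k := Nat.max (fst a) (fst b) in (k, sp_join (liftTo a k) (liftTo b k)).
Definition Linf_orth (F : Cx -> Prop) (a : Linf) : Linf :=
  (fst a, sp_orth F (2 ^ fst a) (snd a)).
Definition Linf_zero : Linf := (0%nat, sp_zero).
Definition Linf_one (F : Cx -> Prop) : Linf := (0%nat, sp_one F 1).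

Fixpoint lincomb (cs : list Cx) (vs : list vec) : vec :=
  match cs, vs with
  | c :: cs', v :: vs' => vadd (vscale c v) (lincomb cs' vs')
  | _, _ => vzero
  end.
Definition has_dim (F : Cx -> Prop) (X : vec -> Prop) (k : nat) : Prop :=
  exists l : list vec, length l = k /\ (forall v, In v l -> X v) /\
    (forall cs, length cs = length l -> (forall c, In c cs -> F c) ->
        lincomb cs l = vzero -> forall c, In c cs -> c = C0) /\
    (forall x, X x -> exists cs, length cs = length l /\
        (forall c, In c cs -> F c) /\ x = lincomb cs l).
Definition dimF (F : Cx -> Prop) (X : vec -> Prop) : nat :=
  epsilon (inhabits 0%nat) (has_dim F X).

Definition delta (F : Cx -> Prop) (a b : Linf) : R :=
  let k := Nat.max (fst a) (fst b) in
  INR (dimF F (sp_join (liftTo a k) (liftTo b k)) - dimF F (sp_meet (liftTo a k) (liftTo b k)))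
  / INR (2 ^ k).

Fixpoint eval_Linf (F : Cx -> Prop) (s : nat -> Linf) (t : term) : Linf :=
  match t with
  | tVar i => s i
  | tMeet a b => Linf_meet (eval_Linf F s a) (eval_Linf F s b)
  | tJoin a b => Linf_join (eval_Linf F s a) (eval_Linf F s b)
  | tOrth a => Linf_orth F (eval_Linf F s a)
  | tZero => Linf_zero
  | tOne => Linf_one F
  end.

Definition delta_Cauchy (F : Cx -> Prop) (u : nat -> Linf) : Prop :=
  forall eps, eps > 0 -> exists N, forall p q, (N <= p)%nat -> (N <= q)%nat ->
    delta F (u p) (u q) < eps.

(* Elements of the metric completion CG(F) are (classes of) delta-Cauchy
   sequences in L_infinity; operations are extended by continuity, i.e. computed
   pointwise; two Cauchy sequences denote the same element iff their distance
   tends to 0. *)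
Definition valid_CG (F : Cx -> Prop) (s t : term) : Prop :=
  forall sg : nat -> nat -> Linf,
    (forall i k, Linf_elem F (sg i k)) ->
    (forall i, delta_Cauchy F (sg i)) ->
    forall eps, eps > 0 -> exists N, forall k, (N <= k)%nat ->
      delta F (eval_Linf F (fun i => sg i k) s) (eval_Linf F (fun i => sg i k) t) < eps.

(* Main.v *)
(** A refutation of an identity [s = t] in some [L(C^d)] can be certified by matrices.
    Represent subspaces by row spaces; a join [M] of [X] and [Y] is witnessed by
    [M = A X + B Y], [X = E M], [Y = G M], an orthocomplement [M] of [X] by
    [M X^* = 0] and [A X + B M = 1], and [s <> t] by a nonzero matrix product.
    Passing to real and imaginary parts turns such a certificate over [C] into one
    over the reals in dimension [2d], i.e. into a real solution of finitely many
    polynomial equations over the integers.  Such a system also has a real algebraic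
    solution: adjoin the coordinates one at a time and move each of them either to a
    nearby rational number, if it satisfies no new relation, or to a nearby root of
    its perturbed minimal polynomial.  Hence the identity already fails in some
    [L(F^2d)].  Adding a zero block carries the failure to every larger dimension,
    and thus to direct limits and to [CG(F)]. *)

Require Import Defs.
From Stdlib Require Import PeanoNat.
From HB Require Import structures.
From mathcomp Require Import all_boot all_order all_algebra.
From mathcomp Require Import boolp reals Rstruct complex polyorder polyrcf lra ring zify.
Set Implicit Arguments.
Unset Strict Implicit.
Unset Printing Implicit Defensive.
Import Order.TTheory GRing.Theory Num.Theory.
Local Open Scope ring_scope.

(** * Real algebraic approximation of finitely generated rings *)

(** A real solution is encoded as a ring homomorphism to the reals from a tower of polynomial rings
    over the integers. It need not be injective: its kernel holds the relations among the
    coordinates, and a perturbed solution is a second homomorphism that still kills a given finite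
    part of that kernel. Closeness alone would not do, since a certificate consists of equations;
    exact vanishing is therefore part of the notion of neighbourhood. The inequation [s <> t] is
    turned into an equation too, by adjoining the inverse of a nonzero entry.

    Real and imaginary parts are separated because [F] may consist of real numbers only, so that a
    complex matrix has no approximation over [F] in its own dimension.

    Subspaces of [F^d] are compared through row spaces over the complex numbers. This is sound
    because Gaussian elimination stays in the field of the entries: kernels, sums and coefficients
    of matrices over [F] can again be found over [F]. *)

Section AlgebraicApproximation.
Variable R : realType.

Definition algebraic_real (x : R) : Prop := algebraicOver (@ratr R) x.

Lemma horner_bound n (p : {poly R}) (y m e : R) :
  (size p <= n)%N -> (forall i, (i < n)%N -> `|p`_i| <= e) -> `|y| <= m ->
  `|p.[y]| <= e * \sum_(i < n) m ^+ i.
Proof.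
move=> sp pe ym; rewrite (horner_coef_wide _ sp) mulr_sumr.
apply: le_trans (ler_norm_sum _ _ _) _; apply: ler_sum => i _.
rewrite normrM normrX; apply: ler_pM; rewrite ?exprn_ge0 //; first exact: pe.
by rewrite lerXn2r ?nnegrE // (le_trans _ ym).
Qed.

(** Joint continuity of evaluation: [(q - p).[z]] is small through the coefficients, uniformly for
    bounded [z] and size at most [n], and [p.[z] - p.[y]] by continuity of [p]. *)
Lemma horner_cont n (p : {poly R}) (y e : R) : 0 < e -> (size p <= n)%N ->
  exists2 eta, 0 < eta & forall (q : {poly R}) z, (size q <= n)%N ->
    (forall i, (i < n)%N -> `|q`_i - p`_i| < eta) -> `|z - y| < eta ->
    `|q.[z] - p.[y]| < e.
Proof.
move=> e0 sp; have e20 : 0 < e / 2 by lra.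
have [d d0 pd] := @poly_cont _ y p _ e20.
pose S := \sum_(i < n) (`|y| + 1) ^+ i.
have S0 : 0 <= S by apply: sumr_ge0 => i _; rewrite exprn_ge0 // addr_ge0.
pose t := e / 2 / (S + 1).
have t0 : 0 < t by rewrite divr_gt0 //; lra.
exists (Num.min 1 (Num.min d t)); first by rewrite !lt_min d0 t0 ltr01.
move=> q z sq qp; rewrite !lt_min => /and3P[z1 zd _].
have -> : q.[z] - p.[y] = (q - p).[z] + (p.[z] - p.[y]).
  by rewrite hornerD hornerN; ring.
apply: le_lt_trans (ler_normD _ _) _.
have bz : `|z| <= `|y| + 1.
  have -> : z = y + (z - y) by ring.
  by rewrite (le_trans (ler_normD _ _)) // lerD2l ltW.
have h : `|(q - p).[z]| <= t * S.
  apply: (@horner_bound n) => //.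
    by rewrite (leq_trans (size_polyD _ _)) // size_polyN geq_max sq sp.
  by move=> i /qp; rewrite !lt_min coefB => /and3P[_ _ /ltW].
have h2 := pd z zd.
have h3 : t * S <= e / 2.
  have -> : t * S = e / 2 * (S / (S + 1)) by rewrite /t; ring.
  rewrite ler_piMr //; first by lra.
  by rewrite ler_pdivrMr; lra.
by lra.
Qed.

(** Write [p = q * ('X - y)]: the cofactor satisfies [q.[y] = p'.[y] != 0] and keeps its sign near
    [y]. A sign change, unlike a root, survives small changes of the coefficients. *)
Lemma simple_root_sign_change (p : {poly R}) (y eta : R) : 0 < eta ->
  root p y -> p^`().[y] != 0 ->
  exists a b, [/\ y - eta < a, a <= b, b < y + eta & p.[a] * p.[b] < 0].
Proof.
move=> eta0 /factor_theorem[q ->].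
rewrite derivM derivXsubC !hornerE subrr mulr0 add0r => qy.
have qy2 : 0 < `|q.[y]| by rewrite normr_gt0.
have [d d0 qd] := @poly_cont _ y q _ qy2.
pose c := Num.min d eta / 2.
have [c0 cd ce] : [/\ 0 < c, c < d & c < eta].
  have : 0 < Num.min d eta by rewrite lt_min d0.
  have : Num.min d eta <= d by rewrite ge_min lexx.
  have : Num.min d eta <= eta by rewrite ge_min lexx orbT.
  by rewrite /c; split; lra.
exists (y - c), (y + c); split; [lra..|].
rewrite !hornerM !hornerXsubC.
have /qd ha : `|y - c - y| < d by rewrite ltr_norml; lra.
have /qd hb : `|y + c - y| < d by rewrite ltr_norml; lra.
have -> : q.[y - c] * (y - c - y) * (q.[y + c] * (y + c - y)) =
  - (q.[y - c] * q.[y + c]) * c ^+ 2 by ring.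
rewrite mulNr oppr_lt0 pmulr_lgt0 ?exprn_gt0 //.
have [q0|q0] := ltP 0 q.[y].
  move: ha hb; rewrite (gtr0_norm q0) !ltr_norml => /andP[? _] /andP[? _].
  by rewrite mulr_gt0; lra.
move: ha hb; rewrite (ler0_norm q0) !ltr_norml => /andP[_ ?] /andP[_ ?].
by rewrite -mulrNN mulr_gt0; lra.
Qed.

(** * Neighbourhoods of a ring homomorphism *)

Section Nearby.
Variables (A : comNzRingType) (phi : {rmorphism A -> R}).

Definition close_to (s : seq A) (e : R) (psi : {rmorphism A -> R}) : Prop :=
  forall a, a \in s -> (phi a = 0 -> psi a = 0) /\ `|psi a - phi a| < e.

(** The neighbourhood filter of [phi]. A basic neighbourhood controls finitely many values up to [e]
    and preserves the vanishing of those that are zero. *)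
Definition nearby (Q : {rmorphism A -> R} -> Prop) : Prop :=
  exists s e, 0 < e /\ forall psi, close_to s e psi -> Q psi.

Lemma nearbyI Q1 Q2 : nearby Q1 -> nearby Q2 -> nearby (fun psi => Q1 psi /\ Q2 psi).
Proof.
move=> [s1 [e1 [e10 h1]]] [s2 [e2 [e20 h2]]].
exists (s1 ++ s2), (Num.min e1 e2); split; first by rewrite lt_min e10.
move=> psi c; split; [apply: h1|apply: h2] => a sa;
  have [|? +] := c a; rewrite ?mem_cat ?sa ?orbT // lt_min => /andP[*]; by split.
Qed.

Lemma nearbyS (Q1 Q2 : _ -> Prop) : (forall psi, Q1 psi -> Q2 psi) -> nearby Q1 -> nearby Q2.
Proof. by move=> h [s [e [e0 c]]]; exists s, e; split=> // psi /c /h. Qed.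

Lemma nearbyT (Q : _ -> Prop) : (forall psi, Q psi) -> nearby Q.
Proof. by move=> h; exists [::], 1; split=> [|psi _]; rewrite ?ltr01. Qed.

Lemma nearby_all (T : eqType) (s : seq T) (Q : T -> _ -> Prop) :
  (forall x, x \in s -> nearby (Q x)) -> nearby (fun psi => forall x, x \in s -> Q x psi).
Proof.
elim: s => [|x s IH] h; first exact: nearbyT.
have hs : nearby (fun psi => forall y, y \in s -> Q y psi).
  by apply: IH => y ys; apply: h; rewrite inE ys orbT.
apply: nearbyS (nearbyI (h x (mem_head _ _)) hs).
by move=> psi [h1 h2] y; rewrite inE => /orP[/eqP->|/h2].
Qed.

Lemma nearby_dist a e : 0 < e -> nearby (fun psi => `|psi a - phi a| < e).
Proof. by move=> e0; exists [:: a], e; split=> // psi /(_ a (mem_head _ _))[]. Qed.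

Lemma nearby_eq0 a : phi a = 0 -> nearby (fun psi => psi a = 0).
Proof.
by move=> a0; exists [:: a], 1; split=> // psi /(_ a (mem_head _ _))[h _]; exact: h.
Qed.

Lemma nearby_neq0 a : phi a != 0 -> nearby (fun psi => psi a != 0).
Proof.
move=> a0; apply: nearbyS (nearby_dist a (e := `|phi a|) _); last by rewrite normr_gt0.
by move=> psi; apply: contraTneq => ->; rewrite sub0r normrN ltxx.
Qed.

Lemma nearby_map_eq0 (p : {poly A}) :
  map_poly phi p = 0 -> nearby (fun psi => map_poly psi p = 0).
Proof.
move=> p0; have h i : i \in iota 0 (size p) -> nearby (fun psi => psi p`_i = 0).
  by move=> _; apply: nearby_eq0; rewrite -coef_map p0 coef0.
apply: nearbyS (nearby_all h) => psi h'; apply/polyP => i; rewrite coef_map coef0 /=.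
case: (ltnP i (size p)) => ip; first by apply: h'; rewrite mem_iota.
by rewrite nth_default // rmorph0.
Qed.

Lemma nearby_horner (p : {poly A}) (y e : R) : 0 < e ->
  exists2 eta, 0 < eta & nearby (fun psi =>
    forall z, `|z - y| < eta -> `|(map_poly psi p).[z] - (map_poly phi p).[y]| < e).
Proof.
move=> e0; have sp : (size (map_poly phi p) <= size p)%N by apply: size_poly.
have [eta eta0 h] := horner_cont y e0 sp.
exists eta => //.
have hi i : i \in iota 0 (size p) -> nearby (fun psi => `|psi p`_i - phi p`_i| < eta).
  by move=> _; apply: nearby_dist.
apply: nearbyS (nearby_all hi) => psi h' z zy; apply: h zy; first exact: size_poly.
by move=> i ip; rewrite !coef_map; apply: h'; rewrite mem_iota.
Qed.

Lemma nearby_horner_seq (s : seq {poly A}) (y e : R) : 0 < e ->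
  exists2 eta, 0 < eta & nearby (fun psi =>
    forall z, `|z - y| < eta -> forall p, p \in s ->
     `|(map_poly psi p).[z] - (map_poly phi p).[y]| < e).
Proof.
move=> e0; elim: s => [|p s [eta1 eta10 h1]]; first by exists 1 => //; exact: nearbyT.
have [eta2 eta20 h2] := nearby_horner p y e0.
exists (Num.min eta1 eta2); first by rewrite lt_min eta10.
apply: nearbyS (nearbyI h1 h2) => psi [k1 k2] z; rewrite lt_min => /andP[z1 z2] q.
by rewrite inE => /orP[/eqP->|/k1]; [exact: k2|exact].
Qed.

(** Homomorphisms with real algebraic values are dense at [phi]; this is the invariant of the
    induction on generators. *)
Definition approximable : Prop := forall Q, nearby Q ->
  exists psi : {rmorphism A -> R}, (forall a, algebraic_real (psi a)) /\ Q psi.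

End Nearby.

Definition poly_ev (A : comNzRingType) (phi : {rmorphism A -> R}) (y : R) : {poly A} -> R :=
  horner_eval y \o map_poly phi.
HB.instance Definition _ A phi y := GRing.RMorphism.on (@poly_ev A phi y).

Lemma algebraic_poly_ev (A : comNzRingType) (psi : {rmorphism A -> R}) z p :
  (forall a, algebraic_real (psi a)) -> algebraic_real z -> algebraic_real (poly_ev psi z p).
Proof.
move=> hpsi hz; rewrite /poly_ev /=; elim/poly_ind: p => [|p c IH].
  by rewrite rmorph0 /horner_eval horner0; apply: algebraic0.
rewrite rmorphD rmorphM /= map_polyX map_polyC /horner_eval !hornerE.
by apply: algebraic_add (hpsi c); apply: algebraic_mul hz.
Qed.

(** * Adjoining one generator *)

Section Step.
Variables (A : comNzRingType) (phi : {rmorphism A -> R}) (y : R).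
Hypothesis approx_phi : approximable phi.

Lemma algebraic_dense eta : 0 < eta -> exists2 z, algebraic_real z & `|z - y| < eta.
Proof.
move=> eta0; have [q] := @rat_in_itvoo R (y - eta) (y + eta) ltac:(lra).
rewrite in_itv /= => /andP[h1 h2]; exists (ratr q); first exact: algebraic_id.
by rewrite ltr_norml; lra.
Qed.

(* [f] is a minimal polynomial of [y] over [phi A]: elements killed at [y] are
   pseudo-divisible by [f], and [y] is a simple root, so it moves continuously. *)
Lemma approx_minimal_root (f : {poly A}) s e : 0 < e ->
  map_poly phi f != 0 -> root (map_poly phi f) y ->
  (forall g : {poly A}, (size g < size f)%N -> root (map_poly phi g) y -> map_poly phi g = 0) ->
  exists psi' : {rmorphism {poly A} -> R},
    (forall a, algebraic_real (psi' a)) /\ close_to (poly_ev phi y) s e psi'.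
Proof.
move=> e0 f0 fy fmin; set c := lead_coef f.
have fn0 : f != 0 by apply: contraNneq f0 => ->; rewrite rmorph0.
(* If [phi] killed the leading coefficient, truncating [f] would give a smaller polynomial with the
   same nonzero image, against minimality. *)
have c0 : phi c != 0.
  apply: contraNneq f0 => c0; pose g := \poly_(i < (size f).-1) f`_i.
  have gf : map_poly phi g = map_poly phi f.
    apply/polyP => i; rewrite !coef_map coef_poly /=.
    case: ltnP => // hi; rewrite rmorph0; move: hi; rewrite leq_eqVlt.
    case/orP => [/eqP<-|hi]; first by rewrite -[f`__]/c c0.
    by rewrite nth_default ?rmorph0 //; move: hi; case: (size f).
  rewrite -gf; apply/eqP/fmin; rewrite ?gf // (leq_ltn_trans (size_poly _ _)) //.
  by rewrite ltn_predL size_poly_gt0.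
have szf : size (map_poly phi f) = size f by rewrite size_map_poly_id0.
(* A derivative vanishing at [y] would have zero image by minimality, impossible in characteristic 0
   for a nonzero polynomial with a root. *)
have df : (map_poly phi f)^`().[y] != 0.
  apply/negP => dy; have : map_poly phi f^`() = 0.
    by apply: fmin; [rewrite lt_size_deriv|rewrite -deriv_map /root].
  rewrite -deriv_map => /(congr1 (fun p : {poly R} => size p)); rewrite size_poly0.
  have := root_size_gt1 f0 fy.
  by rewrite size_deriv; case: size => [|[]].
have [eta eta0 h1] := nearby_horner_seq phi s y e0.
have [a [b [ya ab yb fab]]] := simple_root_sign_change eta0 fy df.
have [hfa hfb] : ((map_poly phi f).[a] != 0) * ((map_poly phi f).[b] != 0).
  by split; apply: contraTneq fab => ->; rewrite ?mul0r ?mulr0 ltxx.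
have near_sign x : (map_poly phi f).[x] != 0 -> nearby phi (fun psi =>
    0 < (map_poly psi f).[x] * (map_poly phi f).[x]).
  move=> hx; have hx' : 0 < `|(map_poly phi f).[x]| by rewrite normr_gt0.
  have [d d0] := nearby_horner phi f x hx'.
  apply: nearbyS => psi /(_ x); rewrite subrr normr0 => /(_ d0).
  set u := (map_poly psi f).[x]; set v := (map_poly phi f).[x].
  have [v0|v0] := ltP 0 v.
    by rewrite (gtr0_norm v0) ltr_norml => /andP[? _]; rewrite mulr_gt0; lra.
  have v1 : v < 0 by rewrite lt_neqAle hx.
  rewrite (ler0_norm v0) ltr_norml => /andP[_ ?].
  by rewrite -mulrNN mulr_gt0; lra.
have h2 p : p \in s -> nearby phi (fun psi => poly_ev phi y p = 0 ->
    forall z, root (map_poly psi f) z -> psi c != 0 -> poly_ev psi z p = 0).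
  move=> _; case: (pselect (poly_ev phi y p = 0)) => [p0|?]; last by apply: nearbyT.
  (* Pseudo-division gives [c ^+ k *: p = q * f + r]. The remainder vanishes at [y], so its image is
     zero by minimality; a [psi] that keeps this and [c] nonzero makes [p] vanish at every root of
     its image of [f]. *)
  case: (Pdiv.ComRing.redivpP p f) => k q r Ep /(_ fn0) sr.
  have r0 : map_poly phi r = 0.
    apply: fmin => //; rewrite /root.
    have := congr1 (fun g => (map_poly phi g).[y]) Ep.
    rewrite /= map_polyZ rmorphD rmorphM /= hornerZ hornerD hornerM (eqP fy) mulr0 add0r.
    by rewrite [X in _ * X]p0 mulr0 => <-.
  apply: nearbyS (nearby_map_eq0 r0) => psi r0' _ z fz cz.
  have := congr1 (fun g => (map_poly psi g).[z]) Ep.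
  rewrite /= map_polyZ rmorphD rmorphM /= hornerZ hornerD hornerM (eqP fz) mulr0 add0r.
  rewrite r0' horner0 => /eqP; rewrite mulf_eq0 => /orP[|/eqP //].
  by rewrite rmorphXn expf_eq0 (negbTE cz) andbF.
have [psi [apsi [[k1 k2] [[k3 k4] k5]]]] := approx_phi
  (nearbyI (nearbyI h1 (nearby_all h2))
    (nearbyI (nearbyI (near_sign a hfa) (near_sign b hfb)) (nearby_neq0 c0))).
have psab : (map_poly psi f).[a] * (map_poly psi f).[b] < 0.
  have := mulr_gt0 k3 k4; rewrite mulrACA => h.
  by rewrite -(nmulr_lgt0 _ fab).
have [z zab fz] := poly_ivtoo ab psab.
have zy : `|z - y| < eta by move: zab; rewrite in_itv /= ltr_norml => /andP[*]; lra.
have az : algebraic_real z.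
  apply/integral_algebraic/(integral_root _ fz).
    apply: contraNneq k5 => E; have := congr1 (fun p : {poly R} => p`_(size f).-1) E.
    by rewrite coef_map coef0 /= => ->.
  by apply/integral_poly => i; rewrite coef_map; apply/integral_algebraic/apsi.
exists (poly_ev psi z); split; first by move=> p; apply: algebraic_poly_ev.
move=> p ps; split; first by move=> p0; apply: k2.
exact: k1.
Qed.

Lemma approximable_poly : approximable (poly_ev phi y).
Proof.
move=> Q [s [e [e0 h]]].
suff [psi [h1 h2]] : exists psi' : {rmorphism {poly A} -> R},
    (forall a, algebraic_real (psi' a)) /\ close_to (poly_ev phi y) s e psi'.
  by exists psi; split=> //; apply: h.
pose P n := `[< exists2 f : {poly A}, size f = n &
  map_poly phi f != 0 /\ root (map_poly phi f) y >].
case: (pselect (exists n, P n)) => [exP|noP].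
  case: (ex_minnP exP) => n /asboolP[f <- [f0 fy]] fmin.
  apply: (approx_minimal_root (f := f)) => // g gf gy; apply/eqP/negP => /negP g0.
  have : P (size g) by apply/asboolP; exists g.
  by move=> /fmin; rewrite leqNgt gf.
(* Transcendental case: a [p] killed at [y] already has zero image coefficient by coefficient. This
   persists under [psi], so the new value of the generator is constrained by closeness only. *)
have [eta eta0 h1] := nearby_horner_seq phi s y e0.
have h2 p : p \in s -> nearby phi (fun psi => poly_ev phi y p = 0 -> map_poly psi p = 0).
  move=> _; case: (pselect (poly_ev phi y p = 0)) => [p0|?]; last by apply: nearbyT.
  have [p0'|p0'] := eqVneq (map_poly phi p) 0.
    by apply: nearbyS (nearby_map_eq0 p0').
  by case: noP; exists (size p); apply/asboolP; exists p => //; split => //; apply/eqP.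
have [psi [apsi [k1 k2]]] := approx_phi (nearbyI h1 (nearby_all h2)).
have [z az zy] := algebraic_dense eta0.
exists (poly_ev psi z); split; first by move=> p; apply: algebraic_poly_ev.
move=> p ps; split; last exact: k1.
by move=> p0; rewrite -[LHS]/((map_poly psi p).[z]) k2 // horner0.
Qed.

End Step.

Lemma approximable_int : approximable (intr : int -> R).
Proof.
move=> Q [s [e [e0 h]]]; exists (intr : int -> R); split.
  by move=> a; have := algebraic_id (@ratr R) a%:~R; rewrite /= ratr_int.
by apply: h => a _; rewrite subrr normr0.
Qed.

Lemma approximable_generators (s : seq R) :
  exists (A : comNzRingType) (phi : {rmorphism A -> R}),
    approximable phi /\ forall x, x \in s -> exists a, phi a = x.
Proof.
elim: s => [|x s [A [phi [aphi h]]]].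
  by exists int, intr; split; [exact: approximable_int|].
exists {poly A}, (poly_ev phi x); split; first exact: approximable_poly.
move=> z; rewrite inE => /orP[/eqP->|/h[a <-]].
  by exists 'X; rewrite /= /poly_ev /= map_polyX /horner_eval hornerX.
by exists a%:P; rewrite /= /poly_ev /= map_polyC /horner_eval hornerC.
Qed.

(** Sums of products are the entries of matrix products, the shape in which the certificate
    equations come. [h] is a plain function, compatible with the listed sums only. *)
Definition respects (h : R -> R) (C : seq (seq (R * R))) : Prop :=
  forall l, l \in C -> h (\sum_(p <- l) p.1 * p.2) = \sum_(p <- l) h p.1 * h p.2.

Lemma algebraic_respects (C : seq (seq (R * R))) :
  exists h : R -> R, [/\ forall x, algebraic_real (h x), h 1 = 1 & respects h C].
Proof.
pose val (l : seq (R * R)) := \sum_(p <- l) p.1 * p.2.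
(* All the reals at which the value of [h] matters: 1, the sums and their factors. The function
   [lft] chooses preimages of these and is arbitrary elsewhere; each listed identity is then an
   element of the kernel of [phi], to be kept by [psi]. *)
pose s := 1 :: [seq val l | l <- C] ++ flatten [seq unzip1 l ++ unzip2 l | l <- C].
have [A [phi [aphi hs]]] := approximable_generators s.
have [lft lftK] : exists lft : R -> A, forall x, x \in s -> phi (lft x) = x.
  have /choice[lft hl] : forall x, exists a, x \in s -> phi a = x.
    by move=> x; case: (boolP (x \in s)) => [/hs[a <-]|_]; [exists a|exists 0].
  by exists lft.
have s1 : 1 \in s by rewrite mem_head.
have sv l : l \in C -> val l \in s.
  by move=> lC; rewrite inE mem_cat (map_f val lC) orbT.
have sp l p : l \in C -> p \in l -> (p.1 \in s) /\ (p.2 \in s).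
  move=> lC pl; rewrite !inE !mem_cat.
  suff [-> ->] : (p.1 \in flatten [seq unzip1 l ++ unzip2 l | l <- C]) /\
       (p.2 \in flatten [seq unzip1 l ++ unzip2 l | l <- C]) by rewrite !orbT.
  by split; apply/flattenP; exists (unzip1 l ++ unzip2 l);
    rewrite ?(map_f _ lC) // mem_cat (map_f _ pl) ?orbT.
have n1 : nearby phi (fun psi => psi (lft 1 - 1) = 0).
  by apply: nearby_eq0; rewrite rmorphB rmorph1 lftK // subrr.
have n2 l : l \in C -> nearby phi (fun psi =>
    psi (lft (val l) - \sum_(p <- l) lft p.1 * lft p.2) = 0).
  move=> lC; apply: nearby_eq0; rewrite rmorphB lftK ?sv // rmorph_sum /=.
  apply/eqP; rewrite subr_eq0; apply/eqP; rewrite /val !big_seq; apply: eq_bigr => p pl.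
  by have [? ?] := sp _ _ lC pl; rewrite rmorphM !lftK.
have [psi [apsi [k1 k2]]] := aphi _ (nearbyI n1 (nearby_all n2)).
exists (psi \o lft); split => //=.
  by move: k1; rewrite rmorphB rmorph1 => /eqP; rewrite subr_eq0 => /eqP.
move=> l /k2; rewrite rmorphB => /eqP; rewrite subr_eq0 => /eqP /= ->.
by rewrite rmorph_sum; apply: eq_bigr => p _; rewrite rmorphM.
Qed.

End AlgebraicApproximation.

(** * Certified values of ortholattice terms *)

Section OrthogonalComplement.
Variable R : realType.
Local Notation C := R[i].

Definition adjmx m n (A : 'M[C]_(m, n)) : 'M[C]_(n, m) := (map_mx (@conjc R) A)^T.

Lemma adjmxK m n (A : 'M[C]_(m, n)) : adjmx (adjmx A) = A.
Proof. by apply/matrixP => i j; rewrite !mxE conjcK. Qed.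

Lemma adjmxM m n p (A : 'M[C]_(m, n)) (B : 'M[C]_(n, p)) :
  adjmx (A *m B) = adjmx B *m adjmx A.
Proof. by rewrite /adjmx map_mxM trmx_mul. Qed.

Lemma adjmx0 m n : adjmx (0 : 'M[C]_(m, n)) = 0.
Proof. by rewrite /adjmx map_mx0 trmx0. Qed.

Lemma rank_adjmx m n (A : 'M[C]_(m, n)) : \rank (adjmx A) = \rank A.
Proof. by rewrite /adjmx mxrank_tr mxrank_map. Qed.

(** The entry is a sum of squared moduli. This anisotropy makes [orthmx] a true complement in
    [cap_orthmx]. *)
Lemma row_adjmx_eq0 n (v : 'rV[C]_n) : v *m adjmx v = 0 -> v = 0.
Proof.
move=> /matrixP/(_ 0 0); rewrite !mxE => h; apply/rowP => i; rewrite mxE; apply/eqP.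
have /psumr_eq0P/(_ h)/(_ i isT)/eqP : forall j, true -> 0 <= v 0 j * adjmx v j 0.
  by move=> j _; rewrite !mxE mulcJ_ge0.
by rewrite !mxE mulf_eq0 conjc_eq0 orbb.
Qed.

Definition orthmx m n (A : 'M[C]_(m, n)) : 'M[C]_n := kermx (adjmx A).

Lemma sub_orthmxP m p n (A : 'M[C]_(m, n)) (B : 'M[C]_(p, n)) :
  reflect (B *m adjmx A = 0) (B <= orthmx A)%MS.
Proof. exact: sub_kermxP. Qed.

Lemma rank_orthmx m n (A : 'M[C]_(m, n)) : \rank (orthmx A) = (n - \rank A)%N.
Proof. by rewrite mxrank_ker rank_adjmx. Qed.

Lemma orthmx_sym m p n (A : 'M[C]_(m, n)) (B : 'M[C]_(p, n)) :
  (A <= orthmx B)%MS -> (B <= orthmx A)%MS.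
Proof.
by move=> /sub_orthmxP/(congr1 (@adjmx _ _)); rewrite adjmxM adjmxK adjmx0 => /sub_orthmxP.
Qed.

Lemma orthmxS m p n (A : 'M[C]_(m, n)) (B : 'M[C]_(p, n)) :
  (A <= B)%MS -> (orthmx B <= orthmx A)%MS.
Proof. by move=> AB; apply: orthmx_sym; apply: submx_trans AB _; apply: orthmx_sym. Qed.

Lemma eqmx_orth m p n (A : 'M[C]_(m, n)) (B : 'M[C]_(p, n)) :
  (A :=: B)%MS -> (orthmx A :=: orthmx B)%MS.
Proof. by move=> AB; apply/eqmxP/andP; split; apply: orthmxS; rewrite AB. Qed.

Lemma orthmxK m n (A : 'M[C]_(m, n)) : (orthmx (orthmx A) :=: A)%MS.
Proof.
apply: eqmx_sym; apply/eqmxP; rewrite -(geq_leqif (mxrank_leqif_eq _)).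
  by rewrite !rank_orthmx subKn // rank_leq_col.
exact: orthmx_sym.
Qed.

Lemma cap_orthmx m n (A : 'M[C]_(m, n)) : (A :&: orthmx A = 0)%MS.
Proof.
apply/eqP; rewrite -submx0; apply/rV_subP => v; rewrite sub_capmx => /andP[vA vO].
suff -> : v = 0 by apply: sub0mx.
by apply: row_adjmx_eq0; apply/sub_orthmxP/orthmx_sym/(submx_trans vA)/orthmx_sym.
Qed.

Lemma sub1_adds_orthmx m n (A : 'M[C]_(m, n)) : (1%:M <= A + orthmx A)%MS.
Proof.
rewrite sub1mx /row_full; have := mxrank_sum_cap A (orthmx A).
by rewrite cap_orthmx mxrank0 addn0 rank_orthmx => ->; rewrite subnKC ?rank_leq_col.
Qed.

End OrthogonalComplement.

(** * Matrix certificates and their direct sums *)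

Section Certificates.
Variable R : realType.
Local Notation C := R[i].

(* Meets go through orthogonal complements, so that joins and complements are the
   only lattice operations to be certified. *)
Fixpoint evm d (sg : nat -> 'M[C]_d) (u : term) : 'M[C]_d :=
  match u with
  | tVar i => sg i
  | tMeet a b => orthmx (orthmx (evm sg a) + orthmx (evm sg b))%MS
  | tJoin a b => (evm sg a + evm sg b)%MS
  | tOrth a => orthmx (evm sg a)
  | tZero => 0
  | tOne => 1%:M
  end.

Definition join_cert d (X Y M : 'M[C]_d) : Prop :=
  exists A B E G : 'M[C]_d, [/\ M = A *m X + B *m Y, X = E *m M & Y = G *m M].

Definition orth_cert d (X M : 'M[C]_d) : Prop :=
  exists A B : 'M[C]_d, M *m adjmx X = 0 /\ A *m X + B *m M = 1%:M.

(* Polynomial identities over [R] witnessing that the row space of [M] is the value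
   of [u]. *)
Fixpoint cert d (sg : nat -> 'M[C]_d) (u : term) (M : 'M[C]_d) : Prop :=
  match u with
  | tVar i => M = sg i
  | tMeet a b => exists X Y X' Y' N, [/\ cert sg a X, cert sg b Y &
      [/\ orth_cert X X', orth_cert Y Y', join_cert X' Y' N & orth_cert N M]]
  | tJoin a b => exists X Y, [/\ cert sg a X, cert sg b Y & join_cert X Y M]
  | tOrth a => exists2 X, cert sg a X & orth_cert X M
  | tZero => M = 0
  | tOne => M = 1%:M
  end.

Lemma join_certP d (X Y M : 'M[C]_d) : join_cert X Y M <-> (M :=: X + Y)%MS.
Proof.
split=> [[A [B [E [G [EM EX EY]]]]]|h].
  apply/eqmxP/andP; split; first by rewrite EM addmx_sub_adds ?submxMl.
  by rewrite addsmx_sub {1}EX EY !submxMl.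
have /sub_addsmxP[[A B] /= EM] : (M <= X + Y)%MS by rewrite h.
have /submxP[E EX] : (X <= M)%MS by rewrite h addsmxSl.
have /submxP[G EY] : (Y <= M)%MS by rewrite h addsmxSr.
by exists A, B, E, G.
Qed.

(** The first equation puts [M] inside the complement of [X]; the second makes [X + M] full, so the
    rank of [M] is at least that of the complement. *)
Lemma orth_certP d (X M : 'M[C]_d) : orth_cert X M <-> (M :=: orthmx X)%MS.
Proof.
split=> [[A [B [h1 h2]]]|h].
  have MX : (M <= orthmx X)%MS by apply/sub_orthmxP.
  apply/eqmxP; rewrite -(geq_leqif (mxrank_leqif_eq MX)) rank_orthmx leq_subLR.
  have E : \rank (X + M)%MS = d.
    by apply/eqP; rewrite -[_ == _]/(row_full _) -sub1mx -h2 addmx_sub_adds ?submxMl.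
  by rewrite -[leqLHS]E; exact: mxrank_adds_leqif.
have := sub1_adds_orthmx X; rewrite (adds_eqmx (eqmx_refl X) (eqmx_sym h)).
move=> /sub_addsmxP[[A B] /= E1]; exists A, B; split=> //.
by apply/sub_orthmxP; rewrite h.
Qed.

Lemma cert_evm d (sg : nat -> 'M[C]_d) u : cert sg u (evm sg u).
Proof.
elim: u => //= [a ha b hb|a ha b hb|a ha].
- exists (evm sg a), (evm sg b), (orthmx (evm sg a)), (orthmx (evm sg b)),
    (orthmx (evm sg a) + orthmx (evm sg b))%MS; split=> //.
  by split; [exact/orth_certP|exact/orth_certP|exact/join_certP|exact/orth_certP].
- by exists (evm sg a), (evm sg b); split=> //; apply/join_certP.
- by exists (evm sg a) => //; apply/orth_certP.
Qed.

Lemma cert_sound d (sg : nat -> 'M[C]_d) u M : cert sg u M -> (M :=: evm sg u)%MS.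
Proof.
elim: u M => /= [i|a ha b hb|a ha b hb|a ha||] M; try by move=> ->.
- move=> [X [Y [X' [Y' [N [/ha hX /hb hY]]]]]].
  move=> [/orth_certP hX' /orth_certP hY' /join_certP hN /orth_certP hM].
  apply: eqmx_trans hM (eqmx_orth _); apply: eqmx_trans hN (adds_eqmx _ _).
    exact: eqmx_trans hX' (eqmx_orth hX).
  exact: eqmx_trans hY' (eqmx_orth hY).
- move=> [X [Y [/ha hX /hb hY /join_certP hM]]].
  exact: eqmx_trans hM (adds_eqmx hX hY).
- by move=> [X /ha hX /orth_certP hM]; exact: eqmx_trans hM (eqmx_orth hX).
Qed.

Lemma adjmx_block d k (A : 'M[C]_d) (B : 'M[C]_k) :
  adjmx (block_mx A 0 0 B) = block_mx (adjmx A) 0 0 (adjmx B).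
Proof. by rewrite /adjmx map_block_mx !map_mx0 tr_block_mx !trmx0. Qed.

Let dsum d k (A : 'M[C]_d) (B : 'M[C]_k) : 'M[C]_(d + k) := block_mx A 0 0 B.

Lemma mulmx_dsum d k (A A' : 'M[C]_d) (B B' : 'M[C]_k) :
  dsum A B *m dsum A' B' = dsum (A *m A') (B *m B').
Proof. by rewrite /dsum mulmx_block !mulmx0 !mul0mx !addr0 !add0r. Qed.

Lemma addmx_dsum d k (A A' : 'M[C]_d) (B B' : 'M[C]_k) :
  dsum A B + dsum A' B' = dsum (A + A') (B + B').
Proof. by rewrite /dsum add_block_mx !addr0. Qed.

Lemma join_cert_dsum d k (X Y M : 'M[C]_d) (X' Y' M' : 'M[C]_k) :
  join_cert X Y M -> join_cert X' Y' M' -> join_cert (dsum X X') (dsum Y Y') (dsum M M').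
Proof.
move=> [A [B [E [G [h1 h2 h3]]]]] [A' [B' [E' [G' [h1' h2' h3']]]]].
exists (dsum A A'), (dsum B B'), (dsum E E'), (dsum G G').
by rewrite !mulmx_dsum addmx_dsum -h1 -h1' -h2 -h2' -h3 -h3'.
Qed.

Lemma orth_cert_dsum d k (X M : 'M[C]_d) (X' M' : 'M[C]_k) :
  orth_cert X M -> orth_cert X' M' -> orth_cert (dsum X X') (dsum M M').
Proof.
move=> [A [B [h1 h2]]] [A' [B' [h1' h2']]]; exists (dsum A A'), (dsum B B').
rewrite adjmx_block !mulmx_dsum addmx_dsum h1 h2 h1' h2' /dsum; split.
  exact: block_mx0.
by rewrite -scalar_mx_block.
Qed.

(** Certificates are matrix equations and so add up blockwise. Through them the value of a term on a
    direct sum is known without computing complements of block matrices. *)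
Lemma cert_dsum d k (sg : nat -> 'M[C]_d) (sg' : nat -> 'M[C]_k) u M M' :
  cert sg u M -> cert sg' u M' ->
  cert (fun i => block_mx (sg i) 0 0 (sg' i)) u (block_mx M 0 0 M').
Proof.
elim: u M M' => /= [i|a ha b hb|a ha b hb|a ha||] M M'; try by move=> -> ->.
- move=> [X [Y [Z [W [N [cX cY [o1 o2 j1 o3]]]]]]].
  move=> [X' [Y' [Z' [W' [N' [cX' cY' [o1' o2' j1' o3']]]]]]].
  exists (dsum X X'), (dsum Y Y'), (dsum Z Z'), (dsum W W'), (dsum N N').
  split; [exact: ha|exact: hb|split; by [apply: orth_cert_dsum|apply: join_cert_dsum]].
- move=> [X [Y [cX cY j]]] [X' [Y' [cX' cY' j']]]; exists (dsum X X'), (dsum Y Y').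
  by split; [exact: ha|exact: hb|exact: join_cert_dsum].
- by move=> [X cX o] [X' cX' o']; exists (dsum X X'); [exact: ha|exact: orth_cert_dsum].
- by move=> -> ->; exact: block_mx0.
- by move=> -> ->; rewrite -scalar_mx_block.
Qed.

Lemma submx_dsum d k (A B : 'M[C]_d) (A' B' : 'M[C]_k) :
  (dsum A A' <= dsum B B')%MS -> (A <= B)%MS.
Proof.
move=> /submxP[D]; rewrite -[D]submxK mulmx_block !mulmx0 !addr0.
by move=> /eq_block_mx[-> _ _ _]; apply: submxMl.
Qed.

(** Only the entries of the assignment are restricted to [S]; values are compared over the complex
    numbers, so validity for different [S] can be compared directly. *)
Definition valid_mx (S : C -> Prop) d s t : Prop := forall sg : nat -> 'M[C]_d,
  (forall n i j, S (sg n i j)) -> (evm sg s :=: evm sg t)%MS.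

(** All variables get 0 in the second block. The terms may take other values there, but the upper
    left block of an inclusion of block diagonal row spaces is already an inclusion. *)
Lemma valid_mx_widen (S : C -> Prop) d k s t : S 0 ->
  valid_mx S (d + k) s t -> valid_mx S d s t.
Proof.
move=> S0 h sg hsg.
have := h (fun i => block_mx (sg i) 0 0 0).
have /cert_sound h1 := cert_dsum (cert_evm sg s) (cert_evm (fun _ => 0 : 'M_k) s).
have /cert_sound h2 := cert_dsum (cert_evm sg t) (cert_evm (fun _ => 0 : 'M_k) t).
move=> h3; have {}h3 : (evm (fun i => block_mx (sg i) 0 0 (0 : 'M_k)) s
    :=: evm (fun i => block_mx (sg i) 0 0 (0 : 'M_k)) t)%MS.
  apply: h3 => n i j; rewrite mxE.
  by case: split => u; rewrite mxE; case: split => v //; rewrite ?mxE.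
have h4 := eqmx_trans h1 (eqmx_trans h3 (eqmx_sym h2)).
pose z u := evm (fun _ => 0 : 'M[C]_k) u.
apply/eqmxP/andP; split.
  by apply: (@submx_dsum _ _ _ _ (z s) (z t)); rewrite /dsum h4.
by apply: (@submx_dsum _ _ _ _ (z t) (z s)); rewrite /dsum h4.
Qed.

End Certificates.

(** * Transfer of certificates to real algebraic matrices *)

Section Transfer.
Variable R : realType.
Local Notation C := R[i].

(** Properties ensured by finitely many identities. They are closed under conjunction, so one call
    of [algebraic_respects] provides all that are needed at once. *)
Definition locally_hom (Q : (R -> R) -> Prop) : Prop :=
  exists K, forall h, h 1 = 1 -> respects h K -> Q h.

Lemma locally_homI Q1 Q2 : locally_hom Q1 -> locally_hom Q2 ->
  locally_hom (fun h => Q1 h /\ Q2 h).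
Proof.
move=> [K1 h1] [K2 h2]; exists (K1 ++ K2) => h e1 hK.
by split; [apply: h1|apply: h2] => // l lK; apply: hK; rewrite mem_cat lK ?orbT.
Qed.

Lemma locally_homS (Q1 Q2 : _ -> Prop) : (forall h, Q1 h -> Q2 h) ->
  locally_hom Q1 -> locally_hom Q2.
Proof. by move=> h [K hK]; exists K => g g1 /(hK g g1)/h. Qed.

Lemma locally_hom0 : locally_hom (fun h => h 0 = 0).
Proof. by exists [:: [::]] => h _ /(_ [::]); rewrite !big_nil; apply. Qed.

Lemma locally_hom1 : locally_hom (fun h => h 1 = 1).
Proof. by exists [::]. Qed.

Lemma locally_hom_neq0 x : x != 0 -> locally_hom (fun h => h x != 0).
Proof.
(* The identity [x * x^-1 = 1] forces [h x] to be invertible. *)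
move=> x0; exists [:: [:: (x, x^-1)]] => h h1 /(_ _ (mem_head _ _)).
rewrite !big_seq1 /= divff // h1; apply: contra_eq_neq => ->.
by rewrite mul0r oner_neq0.
Qed.

Lemma locally_hom_mulmx m n p (X : 'M[R]_(m, n)) (Y : 'M[R]_(n, p)) :
  locally_hom (fun h => map_mx h (X *m Y) = map_mx h X *m map_mx h Y).
Proof.
pose l i j := [seq (X i k, Y k j) | k <- index_enum 'I_n].
exists [seq l i j | i <- enum 'I_m, j <- enum 'I_p] => h _ hK.
apply/matrixP => i j; rewrite !mxE; have := hK (l i j); rewrite /l !big_map.
move=> -> //; last by apply: allpairs_f; rewrite mem_enum.
by apply: eq_bigr => k _; rewrite !mxE.
Qed.

Lemma locally_hom_addmx m n (X Y : 'M[R]_(m, n)) :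
  locally_hom (fun h => map_mx h (X + Y) = map_mx h X + map_mx h Y).
Proof.
(* A sum is made a sum of products by factors 1, which [h] fixes. *)
pose l i j := [:: (X i j, 1 : R); (Y i j, 1)].
exists [seq l i j | i <- enum 'I_m, j <- enum 'I_n] => h h1 hK.
apply/matrixP => i j; rewrite !mxE; have := hK (l i j).
rewrite /l !big_cons !big_nil /= h1 !mulr1 !addr0; apply.
by apply: allpairs_f; rewrite mem_enum.
Qed.

(** The real matrix of right multiplication by [M] on row vectors [x + i y] written as [(x, y)];
    adjoints become transposes. *)
Definition realify m n (M : 'M[C]_(m, n)) : 'M[R]_(m + m, n + n) :=
  block_mx (map_mx (@complex.Re R) M) (map_mx (@complex.Im R) M)
           (- map_mx (@complex.Im R) M) (map_mx (@complex.Re R) M).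

Lemma Re_mulmx m n p (X : 'M[C]_(m, n)) (Y : 'M[C]_(n, p)) :
  map_mx (@complex.Re R) (X *m Y) =
    map_mx (@complex.Re R) X *m map_mx (@complex.Re R) Y -
    map_mx (@complex.Im R) X *m map_mx (@complex.Im R) Y.
Proof.
apply/matrixP => i j; rewrite !mxE.
rewrite (big_morph (@complex.Re R) (id1 := 0) (op1 := +%R)) //; last by move=> [? ?] [? ?].
by rewrite -sumrB; apply: eq_bigr => k _; rewrite !mxE; case: (X i k) (Y k j) => ? ? [].
Qed.

Lemma Im_mulmx m n p (X : 'M[C]_(m, n)) (Y : 'M[C]_(n, p)) :
  map_mx (@complex.Im R) (X *m Y) =
    map_mx (@complex.Re R) X *m map_mx (@complex.Im R) Y +
    map_mx (@complex.Im R) X *m map_mx (@complex.Re R) Y.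
Proof.
apply/matrixP => i j; rewrite !mxE.
rewrite (big_morph (@complex.Im R) (id1 := 0) (op1 := +%R)) //; last by move=> [? ?] [? ?].
by rewrite -big_split; apply: eq_bigr => k _; rewrite !mxE; case: (X i k) (Y k j) => ? ? [].
Qed.

Lemma realifyM m n p (X : 'M[C]_(m, n)) (Y : 'M[C]_(n, p)) :
  realify (X *m Y) = realify X *m realify Y.
Proof.
rewrite /realify mulmx_block Re_mulmx Im_mulmx.
by rewrite !mulmxN !mulNmx opprD [X in block_mx _ _ X _]addrC [X in block_mx _ _ _ X]addrC.
Qed.

Lemma realifyD m n (X Y : 'M[C]_(m, n)) : realify (X + Y) = realify X + realify Y.
Proof.
rewrite /realify add_block_mx -opprD; congr (block_mx _ _ (- _) _);
  by apply/matrixP => i j; rewrite !mxE; case: (X i j) (Y i j) => ? ? [].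
Qed.

Lemma realify_adj m n (X : 'M[C]_(m, n)) : realify (adjmx X) = (realify X)^T.
Proof.
rewrite /realify tr_block_mx; congr block_mx;
  by apply/matrixP => i j; rewrite !mxE; case: (X j i) => ? ? //=; rewrite opprK.
Qed.

Lemma realify0 m n : realify (0 : 'M[C]_(m, n)) = 0.
Proof.
by rewrite /realify !map_mx0 oppr0 block_mx0.
Qed.

Lemma realify1 n : realify (1%:M : 'M[C]_n) = 1%:M.
Proof.
rewrite /realify scalar_mx_block; congr block_mx;
  apply/matrixP => i j; rewrite !mxE; case: eqP => //= _; by rewrite oppr0.
Qed.

Definition transfer (h : R -> R) m n (M : 'M[C]_(m, n)) : 'M[C]_(m + m, n + n) :=
  map_mx (real_complex R) (map_mx h (realify M)).

Lemma locally_hom_transferM m n p (X : 'M[C]_(m, n)) (Y : 'M[C]_(n, p)) :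
  locally_hom (fun h => transfer h (X *m Y) = transfer h X *m transfer h Y).
Proof.
apply: locally_homS (locally_hom_mulmx (realify X) (realify Y)) => h.
by rewrite /transfer realifyM => ->; rewrite map_mxM.
Qed.

Lemma locally_hom_transferD m n (X Y : 'M[C]_(m, n)) :
  locally_hom (fun h => transfer h (X + Y) = transfer h X + transfer h Y).
Proof.
apply: locally_homS (locally_hom_addmx (realify X) (realify Y)) => h.
by rewrite /transfer realifyD => ->; rewrite map_mxD.
Qed.

Lemma transfer_adj h m n (X : 'M[C]_(m, n)) : transfer h (adjmx X) = adjmx (transfer h X).
Proof.
rewrite /transfer realify_adj; apply/matrixP => i j; rewrite !mxE; exact/esym/conjc_real.
Qed.

Lemma locally_hom_transfer0 m n :
  locally_hom (fun h => transfer h (0 : 'M[C]_(m, n)) = 0).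
Proof.
apply: locally_homS locally_hom0 => h h0; rewrite /transfer realify0.
by apply/matrixP => i j; rewrite !mxE h0 rmorph0.
Qed.

Lemma locally_hom_transfer1 n : locally_hom (fun h => transfer h (1%:M : 'M[C]_n) = 1%:M).
Proof.
apply: locally_homS (locally_homI locally_hom0 locally_hom1) => h [h0 h1].
rewrite /transfer realify1; apply/matrixP => i j; rewrite !mxE.
by case: eqP => _; rewrite ?h0 ?h1 ?rmorph0 ?rmorph1.
Qed.

Lemma locally_hom_transfer_neq0 m n (X : 'M[C]_(m, n)) : X != 0 ->
  locally_hom (fun h => transfer h X != 0).
Proof.
move=> /eqP X0; have [i [j Xij]] : exists i j, X i j != 0.
  apply: contrapT => h; apply: X0; apply/matrixP => i j; rewrite mxE.
  by apply/eqP/negPn/negP => Xij; apply: h; exists i, j.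
have /orP[h|h] : (complex.Re (X i j) != 0) || (complex.Im (X i j) != 0).
    by rewrite -negb_and; apply: contraNN Xij; rewrite eq_complex.
  apply: locally_homS (locally_hom_neq0 h) => g; apply: contra_neq.
  move=> /matrixP/(_ (lshift _ i) (lshift _ j)).
  by rewrite /transfer mxE [map_mx g _ _ _]mxE /realify block_mxEul !mxE => -[].
apply: locally_homS (locally_hom_neq0 h) => g; apply: contra_neq.
move=> /matrixP/(_ (lshift _ i) (rshift _ j)).
by rewrite /transfer mxE [map_mx g _ _ _]mxE /realify block_mxEur !mxE => -[].
Qed.

Lemma locally_hom_join_cert d (X Y M : 'M[C]_d) : join_cert X Y M ->
  locally_hom (fun h => join_cert (transfer h X) (transfer h Y) (transfer h M)).
Proof.
move=> [A [B [E [G [hM hX hY]]]]].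
apply: locally_homS (locally_homI (locally_hom_transferD (A *m X) (B *m Y))
 (locally_homI (locally_homI (locally_hom_transferM A X) (locally_hom_transferM B Y))
   (locally_homI (locally_hom_transferM E M) (locally_hom_transferM G M)))).
move=> h [k1 [[k2 k3] [k4 k5]]].
exists (transfer h A), (transfer h B), (transfer h E), (transfer h G).
by rewrite -k2 -k3 -k4 -k5 -k1 -hM -hX -hY.
Qed.

Lemma locally_hom_orth_cert d (X M : 'M[C]_d) : orth_cert X M ->
  locally_hom (fun h => orth_cert (transfer h X) (transfer h M)).
Proof.
move=> [A [B [h1 h2]]].
apply: locally_homS (locally_homI (locally_homI (locally_hom_transferD (A *m X) (B *m M))
   (locally_hom_transferM M (adjmx X)))
 (locally_homI (locally_homI (locally_hom_transferM A X) (locally_hom_transferM B M))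
   (locally_homI (locally_hom_transfer0 d d) (locally_hom_transfer1 d)))).
move=> h [[k1 k2] [[k3 k4] [k5 k6]]]; exists (transfer h A), (transfer h B).
by rewrite -transfer_adj -k3 -k4 -k2 -k1 h1 h2.
Qed.

Lemma locally_hom_cert d (sg : nat -> 'M[C]_d) u M : cert sg u M ->
  locally_hom (fun h => cert (fun i => transfer h (sg i)) u (transfer h M)).
Proof.
elim: u M => /= [i|a ha b hb|a ha b hb|a ha||] M.
- by move=> ->; exists [::].
- move=> [X [Y [Z [W [N [/ha cX /hb cY [o1 o2 j1 o3]]]]]]].
  apply: locally_homS (locally_homI (locally_homI cX cY) (locally_homI
    (locally_homI (locally_hom_orth_cert o1) (locally_hom_orth_cert o2))
    (locally_homI (locally_hom_join_cert j1) (locally_hom_orth_cert o3)))).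
  move=> h [[k1 k2] [[k3 k4] [k5 k6]]].
  by exists (transfer h X), (transfer h Y), (transfer h Z), (transfer h W), (transfer h N).
- move=> [X [Y [/ha cX /hb cY j1]]].
  apply: locally_homS (locally_homI (locally_homI cX cY) (locally_hom_join_cert j1)).
  by move=> h [[k1 k2] k3]; exists (transfer h X), (transfer h Y).
- move=> [X /ha cX o]; apply: locally_homS (locally_homI cX (locally_hom_orth_cert o)).
  by move=> h [k1 k2]; exists (transfer h X).
- by move=> ->; exact: locally_hom_transfer0.
- by move=> ->; exact: locally_hom_transfer1.
Qed.

Lemma valid_algebraic_submx d s t :
  (forall d, valid_mx (fun z : C => exists2 x, algebraic_real x & z = x%:C%C) d s t) ->
  forall sg : nat -> 'M[C]_d, (evm sg s <= evm sg t)%MS.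
Proof.
move=> val sg; apply/negPn/negP => nle.
set Ms := evm sg s; set Mt := evm sg t in nle *.
(* Since [orthmx] is an involution on row spaces, the failure of the inclusion is the nonvanishing
   of a single product. *)
have Z0 : Ms *m adjmx (orthmx Mt) != 0.
  by apply: contraNneq nle => /sub_orthmxP; rewrite orthmxK.
have oMt : orth_cert Mt (orthmx Mt) by apply/orth_certP.
have [K hK] := locally_homI (locally_hom_transferM Ms (adjmx (orthmx Mt)))
  (locally_homI (locally_homI (locally_hom_cert (cert_evm sg s)) (locally_hom_cert (cert_evm sg t)))
  (locally_homI (locally_hom_transfer_neq0 Z0) (locally_hom_orth_cert oMt))).
have [h [ah h1 /(hK h h1)[k1 [[k2 k3] [k4 k5]]]]] := algebraic_respects K.
have {}val : (transfer h Ms :=: transfer h Mt)%MS.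
  apply: eqmx_trans (cert_sound k2) _; apply: eqmx_trans (eqmx_sym (cert_sound k3)).
  apply: val => n i j; rewrite /transfer !mxE.
  exact: (ex_intro2 _ _ _ (ah _) erefl).
(* In dimension [d + d] the assumed identity puts the image of [Ms] inside that of [Mt], so the
   product kept nonzero must vanish. *)
move/orth_certP: k5 => k5; move: k4; rewrite k1 transfer_adj => /eqP; apply.
by apply/sub_orthmxP; rewrite (eqmx_orth k5) orthmxK val.
Qed.

Lemma valid_algebraic d s t :
  (forall d, valid_mx (fun z : C => exists2 x, algebraic_real x & z = x%:C%C) d s t) ->
  valid_mx (fun _ : C => True) d s t.
Proof.
move=> val sg _; apply/eqmxP/andP; split; apply: valid_algebraic_submx => // k sg' h.
exact/eqmx_sym/val.
Qed.

End Transfer.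

(** * Subspaces of F^d as row spaces *)

Section SubfieldMatrices.
Variables (K : fieldType) (S : K -> Prop).

Definition mx_in m n (A : 'M[K]_(m, n)) : Prop := forall i j, S (A i j).

Let in_sub : {pred K} := fun x => `[< S x >].
Hypothesis S_field : divring_closed in_sub.
HB.instance Definition _ := GRing.isDivringClosed.Build K in_sub S_field.
(** With the subfield as a field type of its own, matrix computations can be run inside it. Ranks,
    kernels, sums and inclusions commute with the embedding [val], which yields witnesses with
    entries in [S]. *)
Record subfield_elt := SubfieldElt { subfield_val : K; _ : subfield_val \in in_sub }.
HB.instance Definition _ := [isSub for subfield_val].
HB.instance Definition _ := [Choice of subfield_elt by <:].
HB.instance Definition _ := [SubChoice_isSubComUnitRing of subfield_elt by <:].
HB.instance Definition _ := [SubComUnitRing_isSubIntegralDomain of subfield_elt by <:].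
HB.instance Definition _ := [SubIntegralDomain_isSubField of subfield_elt by <:].

Lemma mx_in_map m n (A : 'M[subfield_elt]_(m, n)) : mx_in (map_mx val A).
Proof. by move=> i j; rewrite mxE; apply/asboolP; exact: (valP (A i j)). Qed.

Lemma mx_in_lift m n (A : 'M[K]_(m, n)) : mx_in A ->
  exists A' : 'M[subfield_elt]_(m, n), A = map_mx val A'.
Proof.
move=> hA; exists (\matrix_(i, j) insubd (0 : subfield_elt) (A i j)).
by apply/matrixP => i j; rewrite !mxE insubdK //; apply/asboolP.
Qed.

Lemma mx_in_ker m n (A : 'M[K]_(m, n)) : mx_in A -> mx_in (kermx A).
Proof. by move=> /mx_in_lift[A' ->]; rewrite -map_kermx; apply: mx_in_map. Qed.

Lemma mx_in_base m n (A : 'M[K]_(m, n)) : mx_in A ->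
  exists2 B : 'M[K]_(\rank A, n), mx_in B & (B :=: A)%MS.
Proof.
move=> /mx_in_lift[A' ->]; rewrite mxrank_map.
exists (map_mx val (row_base A')); first exact: mx_in_map.
by apply/eqmxP; rewrite !map_submx !eq_row_base submx_refl.
Qed.

Lemma mx_in_adds m p n (A : 'M[K]_(m, n)) (B : 'M[K]_(p, n)) : mx_in A -> mx_in B ->
  exists2 M : 'M[K]_n, mx_in M & (M :=: A + B)%MS.
Proof.
move=> /mx_in_lift[A' ->] /mx_in_lift[B' ->]; exists (map_mx val (A' + B')%MS).
  exact: mx_in_map.
exact: map_addsmx.
Qed.

Lemma mx_inM m n p (A : 'M[K]_(m, n)) (B : 'M[K]_(n, p)) :
  mx_in A -> mx_in B -> mx_in (A *m B).
Proof.
by move=> /mx_in_lift[A' ->] /mx_in_lift[B' ->]; rewrite -map_mxM; apply: mx_in_map.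
Qed.

Lemma submx_inP m p n (A : 'M[K]_(m, n)) (B : 'M[K]_(p, n)) : mx_in A -> mx_in B ->
  (A <= B)%MS -> exists2 D, mx_in D & A = D *m B.
Proof.
move=> /mx_in_lift[A' ->] /mx_in_lift[B' ->]; rewrite map_submx => /submxP[D ->].
by exists (map_mx val D); [exact: mx_in_map|rewrite map_mxM].
Qed.

End SubfieldMatrices.

(** De Morgan: reconciles the meet of [evm] with the intersection in [sp_meet]. *)
Lemma sub_orth_adds_orth (R : realType) m p q n (A : 'M[R[i]]_(m, n)) (B : 'M[R[i]]_(p, n))
    (v : 'M[R[i]]_(q, n)) :
  (v <= orthmx (orthmx A + orthmx B)%MS)%MS = (v <= A)%MS && (v <= B)%MS.
Proof.
apply/idP/andP => [h|[vA vB]].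
  by split; [rewrite -(orthmxK A)|rewrite -(orthmxK B)]; apply: submx_trans h _;
    apply: orthmxS; [exact: addsmxSl|exact: addsmxSr].
by apply: orthmx_sym; rewrite addsmx_sub; apply/andP; split; apply: orthmx_sym; rewrite orthmxK.
Qed.

Local Notation R := Rdefinitions.R.
Local Notation C := R[i].

Definition toC (z : Cx) : C := Complex (re z) (im z).
Definition ofC (z : C) : Cx := mkC (complex.Re z) (complex.Im z).

Lemma toCK : cancel toC ofC. Proof. by case. Qed.
Lemma ofCK : cancel ofC toC. Proof. by case. Qed.

Lemma toC_add a b : toC (Cadd a b) = toC a + toC b. Proof. by []. Qed.
Lemma toC_mul a b : toC (Cmul a b) = toC a * toC b. Proof. by []. Qed.

Lemma toC_inv a : toC (Cinv a) = (toC a)^-1.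
Proof.
case: a => x y; rewrite /toC /Cinv /= /GRing.inv /=.
by rewrite !RdivE !RealsE -!expr2 -mulNr.
Qed.

Lemma toC_sum d f : toC (Csum d f) = \sum_(i < d) toC (f i).
Proof. by elim: d => [|d IH] /=; rewrite ?big_ord0 // big_ord_recr /= -IH. Qed.

(** * Translation between predicates on vectors and matrices *)

Section Bridge.
Variables (F : Cx -> Prop) (HF : conj_closed_subfield F).
Let FC (z : C) : Prop := F (ofC z).

Lemma F_field : divring_closed (fun z => `[< FC z >]).
Proof.
have [F0 [F1 [FD [FN [FM [FV _]]]]]] := HF; split.
- exact/asboolP.
- move=> a b /asboolP ha /asboolP hb; apply/asboolP.
  have -> : a - b = toC (Cadd (ofC a) (Copp (ofC b))) by rewrite toC_add ofCK; case: b {hb}.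
  by rewrite /FC toCK; apply: FD => //; apply: FN.
- move=> a b /asboolP ha /asboolP hb; apply/asboolP.
  have [->|b0] := eqVneq b 0; first by rewrite invr0 mulr0; apply: F0.
  have -> : a / b = toC (Cmul (ofC a) (Cinv (ofC b))) by rewrite toC_mul toC_inv !ofCK.
  rewrite /FC toCK; apply: FM => //; apply: FV => // b0'; move/eqP: b0; apply.
  by rewrite -[b]ofCK b0'.
Qed.

Lemma FC_conj z : FC z -> FC (conjc z).
Proof. by case: z => x y; case: HF => _ [_ [_ [_ [_ [_ h]]]]] /h. Qed.

Definition torow d (v : vec) : 'rV[C]_d := \row_i toC (v i).
Definition ofrow d (r : 'rV[C]_d) : vec :=
  fun i => if insub i is Some j then ofC (r 0 j) else C0.

Lemma ofrowK d : cancel (@ofrow d) (@torow d).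
Proof.
move=> r; apply/rowP => i; rewrite mxE /ofrow.
by case: insubP => [j _ /val_inj ->|]; rewrite ?ofCK // ltn_ord.
Qed.

Lemma torowK d v : inF F d v -> ofrow (torow d v) = v.
Proof.
move=> [_ h]; apply: funext => i; rewrite /ofrow.
by case: insubP => [j _ <-|]; rewrite ?mxE ?toCK // -leqNgt => /ssrnat.leP/h ->.
Qed.

Lemma torow_inj d v w : inF F d v -> inF F d w -> torow d v = torow d w -> v = w.
Proof. by move=> /torowK {2}<- /torowK {2}<- ->. Qed.

Lemma mx_in_torow d v : inF F d v -> mx_in FC (torow d v).
Proof. by move=> [h _] i j; rewrite mxE /FC toCK; apply/h/ssrnat.ltP. Qed.

Lemma inF_ofrow d (r : 'rV[C]_d) : mx_in FC r -> inF F d (ofrow r).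
Proof.
move=> hr; split=> i /ssrnat.leP hi; rewrite /ofrow.
  by case: insubP => [j _ _|]; [exact: hr|rewrite hi].
by case: insubP => [j|//]; rewrite ltnNge hi.
Qed.

Lemma torow_add d v w : torow d (vadd v w) = torow d v + torow d w.
Proof. by apply/rowP => i; rewrite !mxE. Qed.

Lemma torow_scale d c v : torow d (vscale c v) = toC c *: torow d v.
Proof. by apply/rowP => i; rewrite !mxE. Qed.

Lemma torow0 d : torow d vzero = 0.
Proof. by apply/rowP => i; rewrite !mxE. Qed.

Lemma inner_eq0 d v w :
  inner d v w = C0 <-> torow d v *m adjmx (torow d w) = 0.
Proof.
have E : toC (inner d v w) = (torow d v *m adjmx (torow d w)) 0 0.
  by rewrite toC_sum mxE; apply: eq_bigr => i _; rewrite !mxE.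
split=> [h|h].
  by apply/matrixP => i j; rewrite !ord1 -E h mxE.
by rewrite -[inner _ _ _]toCK E h mxE.
Qed.

Lemma inF_add d v w : inF F d v -> inF F d w -> inF F d (vadd v w).
Proof.
have [_ [_ [FD _]]] := HF; move=> [h1 h2] [h3 h4]; split=> i hi; rewrite /vadd.
  by apply: FD; [exact: h1|exact: h3].
by rewrite h2 // h4 // -[LHS]toCK toC_add addr0.
Qed.

Lemma inF_scale d c v : F c -> inF F d v -> inF F d (vscale c v).
Proof.
have [_ [_ [_ [_ [FM _]]]]] := HF; move=> hc [h1 h2]; split=> i hi; rewrite /vscale.
  by apply: FM => //; apply: h1.
by rewrite h2 // -[LHS]toCK toC_mul mulr0.
Qed.

Lemma inF_zero d : inF F d vzero.
Proof. by split=> // i _; case: HF. Qed.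

(** The [F]-points of a complex row space. If [M] has entries in [F], its rows are among them and
    the row space can be recovered. *)
Definition spanF d m (M : 'M[C]_(m, d)) : vec -> Prop :=
  fun v => inF F d v /\ (torow d v <= M)%MS.

Lemma spanF_subspace d m (M : 'M[C]_(m, d)) : subspace F d (spanF M).
Proof.
split; first by move=> v [].
split; first by split; [exact: inF_zero|rewrite torow0 sub0mx].
split=> [v w [v1 v2] [w1 w2]|c v hc [v1 v2]].
  by split; [exact: inF_add|rewrite torow_add addmx_sub].
by split; [exact: inF_scale|rewrite torow_scale scalemx_sub].
Qed.

Lemma spanF_row d m (M : 'M[C]_(m, d)) i : mx_in FC M -> spanF M (ofrow (row i M)).
Proof.
move=> hM; split; last by rewrite ofrowK row_sub.
by apply: inF_ofrow => i' j; rewrite mxE; apply: hM.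
Qed.

Lemma spanF_eqmx d m p (M : 'M[C]_(m, d)) (N : 'M[C]_(p, d)) :
  (M :=: N)%MS -> spanF M = spanF N.
Proof. by move=> h; rewrite predeqE => v; rewrite /spanF h. Qed.

Lemma spanF_sub d m p (M : 'M[C]_(m, d)) (N : 'M[C]_(p, d)) : mx_in FC M ->
  (forall v, spanF M v -> spanF N v) -> (M <= N)%MS.
Proof.
move=> hM h; apply/row_subP => i.
by have [_] := h _ (spanF_row i hM); rewrite ofrowK.
Qed.

Lemma spanF_inj d m p (M : 'M[C]_(m, d)) (N : 'M[C]_(p, d)) : mx_in FC M -> mx_in FC N ->
  spanF M = spanF N -> (M :=: N)%MS.
Proof.
by move=> hM hN E; apply/eqmxP/andP; split; apply: spanF_sub => // v; rewrite E.
Qed.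

Lemma subspace_lincomb d X m (M : 'M[C]_(m, d)) (r : 'rV[C]_d) : subspace F d X ->
  mx_in FC M -> (forall i, X (ofrow (row i M))) -> mx_in FC r -> (r <= M)%MS -> X (ofrow r).
Proof.
move=> [XF [X0 [XD XZ]]] hM hX hr /(submx_inP F_field hr hM)[D hD ->].
rewrite mulmx_sum_row.
suff: forall s : seq 'I_m, X (ofrow (\sum_(i <- s) D 0 i *: row i M)) by apply.
elim=> [|i s IH].
  rewrite big_nil; suff -> : ofrow (0 : 'rV[C]_d) = vzero by [].
  by apply: funext => i; rewrite /ofrow; case: insub => // j; rewrite mxE.
rewrite big_cons.
suff -> : ofrow (D 0 i *: row i M + \sum_(j <- s) D 0 j *: row j M) =
    vadd (vscale (ofC (D 0 i)) (ofrow (row i M))) (ofrow (\sum_(j <- s) D 0 j *: row j M)).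
  by apply: XD IH; apply: XZ => //; apply: hD.
have h1 : inF F d (vscale (ofC (D 0 i)) (ofrow (row i M))).
  by apply: inF_scale; [exact: hD|exact/XF/hX].
rewrite -[RHS](@torowK d); last by apply: inF_add => //; exact: XF IH.
by rewrite torow_add torow_scale !ofrowK ofCK.
Qed.

(** Take a matrix over [F] with rows in [X] of maximal rank. Appending a vector of [X] cannot raise
    the rank, so the vector is already spanned. *)
Lemma subspace_span d X : subspace F d X ->
  exists2 M : 'M[C]_d, mx_in FC M & X = spanF M.
Proof.
move=> sX; have [XF [X0 _]] := sX.
pose good (M : 'M[C]_d) := mx_in FC M /\ forall i, X (ofrow (row i M)).
pose P k := `[< exists2 M, good M & \rank M = k >].
have exP : exists k, P k.
  exists 0%N; apply/asboolP; exists (0 : 'M_d); last exact: mxrank0.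
  have e0 : ofrow (0 : 'rV[C]_d) = vzero.
    by apply: funext => j; rewrite /ofrow; case: insub => // k; rewrite mxE.
  split=> [i j|i]; first by rewrite mxE; case: HF.
  by rewrite row0 e0.
have ubP k : P k -> (k <= d)%N by move=> /asboolP[M _ <-]; apply: rank_leq_col.
case: (ex_maxnP exP ubP) => k /asboolP[M [hM hX] <-] maxk.
exists M => //; rewrite predeqE => v; split=> [Xv|[v1 v2]]; last first.
  by rewrite -(torowK v1); apply: subspace_lincomb v2 => //; exact: mx_in_torow.
split; first exact: XF.
have hv := mx_in_torow (XF _ Xv).
have [N hN eN] := mx_in_adds F_field hM hv.
have /maxk : P (\rank N).
  apply/asboolP; exists N => //; split=> // i.
  have hc : mx_in FC (col_mx M (torow d v)).
    by move=> i' j; rewrite mxE; case: split => ?; [exact: hM|exact: hv].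
  apply: (subspace_lincomb (M := col_mx M (torow d v))) => //.
  - move=> i'; case: (splitP i') => j Ej.
      have -> : i' = lshift 1 j by apply: val_inj.
      by rewrite rowKu.
    have -> : i' = rshift d j by apply: val_inj.
    rewrite rowKd; have -> : row j (torow d v) = torow d v.
      by apply/rowP => l; rewrite !mxE.
    by rewrite torowK //; exact: XF.
  - by move=> i' j; rewrite mxE; apply: hN.
  - by rewrite -addsmxE -eN row_sub.
rewrite eN => le; have := mxrank_leqif_sup (addsmxSl M (torow d v)).
by move/geq_leqif; rewrite le addsmx_sub => /esym/andP[].
Qed.

(** A vector over [F] in the complex sum has coefficients over [F], so its two summands can be taken
    over [F] as well. *)
Lemma spanF_adds d (M N : 'M[C]_d) : mx_in FC M -> mx_in FC N ->
  spanF (M + N)%MS = sp_join (spanF M) (spanF N).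
Proof.
move=> hM hN; rewrite predeqE => v; split.
  move=> [v1]; rewrite addsmxE => v2.
  have hc : mx_in FC (col_mx M N) by move=> i j; rewrite mxE; case: split.
  have [D hD] := submx_inP F_field (mx_in_torow v1) hc v2.
  rewrite -[D]hsubmxK mul_row_col => Ev.
  have h1 : mx_in FC (lsubmx D *m M).
    by apply: (mx_inM F_field) => // i j; rewrite mxE; apply: hD.
  have h2 : mx_in FC (rsubmx D *m N).
    by apply: (mx_inM F_field) => // i j; rewrite mxE; apply: hD.
  exists (ofrow (lsubmx D *m M)), (ofrow (rsubmx D *m N)).
  split; [|split].
  - by split; [exact: inF_ofrow|rewrite ofrowK submxMl].
  - by split; [exact: inF_ofrow|rewrite ofrowK submxMl].
  - apply: (torow_inj v1); first by apply: inF_add; exact: inF_ofrow.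
    by rewrite torow_add !ofrowK.
move=> [x [y [[x1 x2] [[y1 y2] ->]]]]; split; first exact: inF_add.
by rewrite torow_add addmx_sub_adds.
Qed.

Lemma spanF_orth d (M : 'M[C]_d) : mx_in FC M ->
  spanF (orthmx M) = sp_orth F d (spanF M).
Proof.
move=> hM; rewrite predeqE => v; split=> -[v1 v2]; split=> //.
  move=> w [w1 w2]; apply/inner_eq0; apply/sub_orthmxP.
  exact: submx_trans v2 (orthmxS w2).
apply: orthmx_sym; apply/row_subP => i; apply: orthmx_sym; apply/sub_orthmxP.
by have /inner_eq0 := v2 _ (spanF_row i hM); rewrite ofrowK.
Qed.

(** The adjoint stays over [F] by closure under conjugation, and kernels stay over any subfield. *)
Lemma mx_in_orth d (M : 'M[C]_d) : mx_in FC M -> mx_in FC (orthmx M).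
Proof.
by move=> hM; apply: mx_in_ker F_field _ _ _ _ => i j; rewrite !mxE; apply/FC_conj/hM.
Qed.

Lemma evm_in d (sg : nat -> 'M[C]_d) u : (forall i, mx_in FC (sg i)) ->
  exists2 M : 'M[C]_d, mx_in FC M & (M :=: evm sg u)%MS.
Proof.
move=> hsg; elim: u => /= [i|a [A hA eA] b [B hB eB]|a [A hA eA] b [B hB eB]|a [A hA eA]||].
- by exists (sg i).
- have [M hM eM] := mx_in_adds F_field (mx_in_orth hA) (mx_in_orth hB).
  exists (orthmx M); first exact: mx_in_orth.
  apply: eqmx_orth; apply: eqmx_trans eM _.
  by apply: adds_eqmx; apply: eqmx_orth.
- have [M hM eM] := mx_in_adds F_field hA hB; exists M => //.
  by apply: eqmx_trans eM _; apply: adds_eqmx.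
- by exists (orthmx A); [exact: mx_in_orth|exact: eqmx_orth].
- by exists 0 => // i j; rewrite mxE; case: HF.
- exists 1%:M => // i j; rewrite mxE; case: HF => F0 [F1 _].
  by case: eqP.
Qed.

Lemma eval_spanF d (sg : nat -> 'M[C]_d) u : (forall i, mx_in FC (sg i)) ->
  eval_sp F d (fun i => spanF (sg i)) u = spanF (evm sg u).
Proof.
move=> hsg; elim: u => //= [a -> b ->|a -> b ->|a ->||].
- rewrite predeqE => v; rewrite /spanF sub_orth_adds_orth /sp_meet.
  split=> [[[v1 v2] [_ v3]]|[v1 /andP[v2 v3]]]; first by rewrite v2 v3.
  by [].
- have [A hA eA] := evm_in a hsg; have [B hB eB] := evm_in b hsg.
  rewrite -(spanF_eqmx eA) -(spanF_eqmx eB) -spanF_adds //.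
  by apply: spanF_eqmx; apply: adds_eqmx.
- have [A hA eA] := evm_in a hsg.
  rewrite -(spanF_eqmx eA) -spanF_orth //.
  exact: spanF_eqmx (eqmx_orth eA).
- rewrite predeqE => v; split=> [->|[v1]].
    by split; [exact: inF_zero|rewrite torow0 sub0mx].
  rewrite submx0 => /eqP v0; apply: (torow_inj v1 (inF_zero d)).
  by rewrite torow0.
- by rewrite predeqE => v; split=> [v1|[]]; [split=> //; rewrite submx1|].
Qed.

Lemma valid_LFE d s t : valid_LF F d s t <-> valid_mx FC d s t.
Proof.
split=> h.
  move=> sg hsg; have [A hA eA] := evm_in s hsg; have [B hB eB] := evm_in t hsg.
  apply: eqmx_trans (eqmx_sym eA) (eqmx_trans _ eB); apply: spanF_inj => //.
  rewrite (spanF_eqmx eA) (spanF_eqmx eB) -!eval_spanF // predeqE => v.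
  by apply: h => i; apply: spanF_subspace.
move=> sg hsg v.
have /choice[M hM] : forall i, exists M : 'M[C]_d, mx_in FC M /\ sg i = spanF M.
  by move=> i; have [M ? ?] := subspace_span (hsg i); exists M.
have -> : sg = fun i => spanF (M i) by apply: funext => i; case: (hM i).
have hM' i : mx_in FC (M i) by case: (hM i).
by rewrite !eval_spanF // (spanF_eqmx (h M hM')).
Qed.

Lemma valid_LF_widen d k s t : valid_LF F (d + k) s t -> valid_LF F d s t.
Proof.
move=> /valid_LFE h; apply/valid_LFE; apply: valid_mx_widen h.
by case: HF.
Qed.

End Bridge.

Definition Z_of_int (z : int) : BinNums.Z :=
  match z with Posz n => BinInt.Z.of_nat n | Negz n => BinInt.Z.opp (BinInt.Z.of_nat n.+1) end.

Lemma IZR_Z_of_int z : Rdefinitions.IZR (Z_of_int z) = z%:~R.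
Proof.
case: z => n; rewrite /Z_of_int; first by rewrite -RIneq.INR_IZR_INZ INRE.
by rewrite RIneq.opp_IZR -RIneq.INR_IZR_INZ INRE NegzE.
Qed.

Lemma poly_eval_Poly (s : seq int) (x : R) :
  poly_eval (map Z_of_int s) x = (Poly [seq c%:~R | c <- s]).[x].
Proof.
elim: s => [|c s IH] /=; first by rewrite horner0.
by rewrite IH horner_cons IZR_Z_of_int RplusE RmultE addrC mulrC.
Qed.

Lemma algebraic_real_algebraic (x : R) : algebraic_real x -> real_algebraic x.
Proof.
move=> [p p0]; case: (rat_poly_scale p) => q [a a0 Ep].
have q0 : q != 0 by apply: contraNneq p0 => q0; rewrite Ep q0 rmorph0 scaler0.
rewrite Ep map_polyZ rootZ; last by rewrite fmorph_eq0 invr_eq0 intr_eq0.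
rewrite -map_poly_comp (eq_map_poly (g := intr)) => [|z /=]; last by rewrite ratr_int.
rewrite /root => /eqP qx; exists (map Z_of_int q); split; last first.
  by rewrite poly_eval_Poly -map_polyE qx.
have /(_ q) : forall s : seq int, (exists2 c, c \in s & c != 0) ->
    exists c, List.In c (map Z_of_int s) /\ c <> BinNums.Z0.
  elim=> [|c s IH] [c' //]; rewrite inE => /orP[/eqP-> c0|c's c0].
    by exists (Z_of_int c); split; [left|case: c c0 => [[]|]].
  by have [|z [? ?]] := IH; [exists c'|exists z; split=> //; right].
apply; exists (lead_coef q); last by rewrite lead_coef_eq0.
by rewrite lead_coefE mem_nth // prednK // size_poly_gt0.
Qed.

Lemma Call_subfield : conj_closed_subfield Call.
Proof. by do !split. Qed.

(** A stage at which [u] can be computed when variable [i] lives at stage [m i]. An assignment may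
    have unbounded stages; only the variables of [u] count. *)
Fixpoint level (m : nat -> nat) (u : term) : nat :=
  match u with
  | tVar i => m i
  | tMeet a b | tJoin a b => Nat.max (level m a) (level m b)
  | tOrth a => level m a
  | tZero | tOne => 0%N
  end.

Section Consequences.
Variables (F : Cx -> Prop) (HF : conj_closed_subfield F) (HA : contains_real_algebraics F).
Let FC (z : C) : Prop := F (ofC z).

Lemma QL_N_F s t : QL_N s t <-> (forall d, valid_LF F d s t).
Proof.
split=> h d.
  (* An assignment over [F] is also one over the complex numbers. *)
  apply/(valid_LFE HF) => sg hsg.
  by apply: (valid_LFE Call_subfield d s t).1 => //; apply: h.
apply/(valid_LFE Call_subfield) => sg _; apply: (valid_algebraic (R := R)) => // k sg' hsg'.
apply: (valid_LFE HF k s t).1 => // n i j; have [x ax ->] := hsg' n i j.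
exact/HA/algebraic_real_algebraic.
Qed.

Lemma eval_subspace d sg u : (forall i, subspace F d (sg i)) -> subspace F d (eval_sp F d sg u).
Proof.
move=> hsg; have /choice[M hM] : forall i, exists M : 'M[C]_d, mx_in FC M /\ sg i = spanF F M.
  by move=> i; have [M ? ?] := subspace_span HF (hsg i); exists M.
have -> : sg = fun i => spanF F (M i) by apply: funext => i; case: (hM i).
by rewrite eval_spanF //; [exact: spanF_subspace|move=> i; case: (hM i)].
Qed.

Lemma valid_LF_le d d' s t : (d <= d')%N -> valid_LF F d' s t -> valid_LF F d s t.
Proof. by move=> /subnKC <-; apply: valid_LF_widen. Qed.

(** * Direct limits *)

Section DirectLimit.
Variables (dn : nat -> nat) (f : nat -> (vec -> Prop) -> (vec -> Prop)) (L : OL)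
  (g : nat -> (vec -> Prop) -> L).
Hypothesis f_emb : forall n, sp_embedding F (dn n) (dn n.+1) (f n).
Hypothesis limL : is_direct_limit F dn f L g.

Lemma limit_push n X N : (n <= N)%N -> subspace F (dn n) X ->
  exists2 Y, subspace F (dn N) Y & g N Y = g n X.
Proof.
move=> /subnKC <-; elim: (N - n)%N => [|k IH] sX; first by rewrite addn0; exists X.
have [Y sY <-] := IH sX; have [_ [gf _]] := limL; rewrite addnS.
by exists (f (n + k) Y); [have [h _] := f_emb (n + k); exact: h|exact: gf].
Qed.

Lemma limit_eval N (sg : nat -> vec -> Prop) (sgL : nat -> L) (m : nat -> nat) u :
  (forall i, subspace F (dn N) (sg i)) ->
  (forall i, (m i <= N)%N -> g N (sg i) = sgL i) -> (level m u <= N)%N ->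
  g N (eval_sp F (dn N) sg u) = eval_OL L sgL u.
Proof.
move=> ssg hsg; have [/(_ N)[gm [gj [go [g0 [g1 _]]]]] _] := limL.
elim: u => //= [a ha b hb|a ha b hb|a ha].
- by move=> h; rewrite gm; [rewrite ha ?hb //; lia|exact: eval_subspace..].
- by move=> h; rewrite gj; [rewrite ha ?hb //; lia|exact: eval_subspace..].
- by move=> h; rewrite go; [rewrite ha|exact: eval_subspace].
Qed.

Lemma QL_N_limit s t : (forall M, exists N, forall n, (N <= n)%N -> (M <= dn n)%N) ->
  QL_N s t <-> valid_OL L s t.
Proof.
move=> dinf; rewrite QL_N_F; split=> h.
  move=> sgL; have [_ [_ sur]] := limL.
  have /choice[m hm] : forall i, exists n, exists2 X, subspace F (dn n) X & g n X = sgL i.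
    by move=> i; have [n [X [? ?]]] := sur (sgL i); exists n, X.
  pose N := Nat.max (level m s) (level m t).
  have /choice[sg hsg] : forall i, exists X, subspace F (dn N) X /\
      ((m i <= N)%N -> g N X = sgL i).
    move=> i; have [X sX gX] := hm i; case: (leqP (m i) N) => hi.
      by have [Y sY gY] := limit_push hi sX; exists Y; rewrite gY.
    (* A variable living beyond stage [N] occurs in neither term; the zero subspace is a default. *)
    by exists (spanF F (0 : 'M[C]_(dn N))); split=> //; exact: spanF_subspace.
  have e u : (level m u <= N)%N -> eval_OL L sgL u = g N (eval_sp F (dn N) sg u).
    by move=> hu; rewrite (limit_eval (m := m) (sgL := sgL)) // => i; case: (hsg i).
  rewrite !e ?/N; try lia; congr (g _ _); rewrite predeqE => v.
  by apply: h => i; case: (hsg i).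
(* Conversely, a stage of dimension at least [d] embeds in [L]; injectivity of [g N] reflects the
   identity to it, and widening brings it down to [d]. *)
move=> d; have [N /(_ N (leqnn _)) dN] := dinf d.
apply: (valid_LF_le dN) => sg hsg v.
have [/(_ N)[_ [_ [_ [_ [_ gi]]]]] _] := limL.
have e u : g N (eval_sp F (dn N) sg u) = eval_OL L (fun i => g N (sg i)) u.
  apply: (limit_eval (m := fun _ => 0%N)) => //.
  by elim: u => //= a ha b hb; lia.
suff -> : eval_sp F (dn N) sg s = eval_sp F (dn N) sg t by [].
by apply: gi; [exact: eval_subspace..|rewrite !e].
Qed.

End DirectLimit.

(** * Dimension over F and matrix rank *)

Lemma In_nth (T : Type) (x0 : T) (l : list T) x :
  List.In x l -> exists2 i, (i < size l)%N & nth x0 l i = x.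
Proof.
elim: l => [|w l IH] //= [->|/IH[i il <-]]; first by exists 0%N.
by exists i.+1.
Qed.

Lemma nth_In (T : Type) (x0 : T) (l : list T) i : (i < size l)%N -> List.In (nth x0 l i) l.
Proof. by elim: l i => [|w l IH] //= [|i] il; [left|right; apply: IH]. Qed.

Lemma torow_lincomb d cs l : size cs = size l ->
  torow d (lincomb cs l) = \sum_(i < size l) toC (nth C0 cs i) *: torow d (nth vzero l i).
Proof.
elim: l cs => [|v l IH] [|c cs] //=; first by rewrite big_ord0 torow0.
by move=> [/IH e]; rewrite big_ord_recl /= torow_add torow_scale e.
Qed.

Definition mx_of_list d (l : list vec) : 'M[C]_(size l, d) :=
  \matrix_(i < size l) torow d (nth vzero l i).

Definition row_of_list n (cs : list Cx) : 'rV[C]_n := \row_(i < n) toC (nth C0 cs i).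

Lemma torow_lincomb_mx d cs l : size cs = size l ->
  torow d (lincomb cs l) = row_of_list (size l) cs *m mx_of_list d l.
Proof.
move=> /torow_lincomb ->; rewrite mulmx_sum_row.
by apply: eq_bigr => i _; rewrite mxE rowK.
Qed.

Definition list_of_row n (r : 'rV[C]_n) : list Cx := [seq ofC (r 0 i) | i <- enum 'I_n].

Lemma size_list_of_row n (r : 'rV[C]_n) : size (list_of_row r) = n.
Proof. by rewrite size_map size_enum_ord. Qed.

Lemma nth_list_of_row n (r : 'rV[C]_n) (i : 'I_n) : nth C0 (list_of_row r) i = ofC (r 0 i).
Proof. by rewrite (nth_map i) ?size_enum_ord // nth_ord_enum. Qed.

Lemma list_of_rowK n (r : 'rV[C]_n) : row_of_list n (list_of_row r) = r.
Proof. by apply/rowP => i; rewrite mxE nth_list_of_row ofCK. Qed.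

Lemma In_list_of_row n (r : 'rV[C]_n) c : List.In c (list_of_row r) -> exists i, c = ofC (r 0 i).
Proof.
move=> /(In_nth C0)[k]; rewrite size_list_of_row => il <-.
by exists (Ordinal il); rewrite -nth_list_of_row.
Qed.

Lemma lincomb_in d X cs l : subspace F d X -> size cs = size l ->
  (forall v, List.In v l -> X v) -> (forall c, List.In c cs -> F c) -> X (lincomb cs l).
Proof.
move=> [_ [X0 [XD XZ]]]; elim: l cs => [|v l IH] [|c cs] //= [sc] hl hc.
apply: XD; first by apply: XZ; [apply: hc|apply: hl]; left.
by apply: IH => // *; [apply: hl|apply: hc]; right.
Qed.

(** The basis gives a matrix over [F] whose left kernel is again over [F], so independence over [F]
    implies independence over the complex numbers. This uniqueness, with the existence in
    [has_dim_span], determines the [epsilon] in [dimF]. *)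
Lemma has_dim_rank d m (M : 'M[C]_(m, d)) k : mx_in FC M ->
  has_dim F (spanF F M) k -> k = \rank M.
Proof.
move=> hM [l [<- [hl [ind span]]]]; set L := mx_of_list d l.
have hlF i : (i < size l)%N -> spanF F M (nth vzero l i).
  by move=> il; apply/hl/nth_In.
have hL : mx_in FC L.
  move=> i j; rewrite mxE; have [h _] := hlF i (ltn_ord i).
  exact: mx_in_torow.
have LM : (L :=: M)%MS.
  apply/eqmxP/andP; split; apply/row_subP => i.
    by rewrite rowK; case: (hlF i (ltn_ord i)).
  have [cs [scs [_ e]]] := span _ (spanF_row i hM).
  have := congr1 (torow d) e; rewrite ofrowK => ->.
  by rewrite torow_lincomb_mx // submxMl.
suff /eqP fL : row_free L by rewrite -LM fL.
rewrite -kermx_eq0; apply/eqP/row_matrixP => i; rewrite row0.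
set r := row i _.
have hr : mx_in FC r.
  by move=> a b; rewrite mxE; apply: (mx_in_ker (F_field HF) hL).
have lr : forall c, List.In c (list_of_row r) -> F c.
  by move=> c /In_list_of_row[j ->]; apply: hr.
have z : lincomb (list_of_row r) l = vzero.
  have h : spanF F M (lincomb (list_of_row r) l).
    by apply: (lincomb_in (spanF_subspace HF M)) => //; rewrite size_list_of_row.
  apply: (@torow_inj F d); [by case: h|exact: inF_zero|].
  rewrite torow_lincomb_mx ?size_list_of_row // list_of_rowK torow0.
  by rewrite /r -row_mul mulmx_ker row0.
have c0 := ind (list_of_row r) (size_list_of_row r) lr z.
apply/rowP => j; have : nth C0 (list_of_row r) j = C0.
  by apply: c0; apply: nth_In; rewrite size_list_of_row.
by rewrite nth_list_of_row => /(congr1 toC); rewrite ofCK => ->; rewrite mxE.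
Qed.

Lemma has_dim_span d m (M : 'M[C]_(m, d)) : mx_in FC M -> has_dim F (spanF F M) (\rank M).
Proof.
move=> hM; have [B hB eB] := mx_in_base (F_field HF) hM.
pose l := [seq ofrow (row i B) | i <- enum 'I_(\rank M)].
have sl : size l = \rank M by rewrite size_map size_enum_ord.
have nl (i : 'I_(\rank M)) : nth vzero l i = ofrow (row i B).
  by rewrite (nth_map i) ?size_enum_ord // nth_ord_enum.
have comb cs : size cs = size l -> torow d (lincomb cs l) = row_of_list (\rank M) cs *m B.
  move=> scs; rewrite torow_lincomb // mulmx_sum_row sl.
  by apply: eq_bigr => i _; rewrite mxE nl ofrowK.
have fB : row_free B by rewrite /row_free eB.
have lX v : List.In v l -> spanF F M v.
  move=> /(In_nth vzero)[k]; rewrite sl => il <-.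
  by rewrite -(spanF_eqmx F eB) (nl (Ordinal il)); apply: spanF_row.
exists l; split=> //; split=> //; split.
  move=> cs scs hcs z c /(In_nth C0)[i ics <-].
  have ir : (i < \rank M)%N by rewrite -sl -(scs : size cs = size l).
  have := comb cs scs; rewrite z torow0 => /esym/eqP.
  rewrite mulmx_free_eq0 // => /eqP/rowP/(_ (Ordinal ir)); rewrite !mxE /= => e.
  by rewrite -[nth _ _ _]toCK e.
move=> x [xF]; rewrite -eB => xB.
have [D hD e] := submx_inP (F_field HF) (mx_in_torow xF) hB xB.
have sD : size (list_of_row D) = size l by rewrite sl size_list_of_row.
have hc : forall c, List.In c (list_of_row D) -> F c.
  by move=> c /In_list_of_row[j ->]; apply: hD.
exists (list_of_row D); split=> //; split=> //.
apply: (torow_inj xF); last by rewrite comb // list_of_rowK.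
by have [] := lincomb_in (spanF_subspace HF M) sD lX hc.
Qed.

Lemma dimF_span d m (M : 'M[C]_(m, d)) : mx_in FC M -> dimF F (spanF F M) = \rank M.
Proof.
move=> hM; apply: has_dim_rank => //.
by apply: ClassicalEpsilon.epsilon_spec; exists (\rank M); exact: has_dim_span.
Qed.

(** Truncated subtraction only yields that the join is no larger than the meet. As the meet lies in
    the join, both coincide, and [X] and [Y] lie in between. *)
Lemma dim_join_meet_eq d X Y : subspace F d X -> subspace F d Y ->
  (dimF F (sp_join X Y) - dimF F (sp_meet X Y))%N = 0%N -> X = Y.
Proof.
move=> /(subspace_span HF)[M hM ->] /(subspace_span HF)[N hN ->].
have em : sp_meet (spanF F M) (spanF F N) = spanF F (M :&: N)%MS.
  rewrite predeqE => v; rewrite /spanF /sp_meet sub_capmx.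
  by split=> [[[? ->] [_ ->]]|[? /andP[]]].
have [P hP eP] := subspace_span HF (spanF_subspace HF (M :&: N)%MS).
have PM : (P <= M)%MS.
  by apply: spanF_sub hP _ => v; rewrite -eP -em => -[].
have PN : (P <= N)%MS.
  by apply: spanF_sub hP _ => v; rewrite -eP -em => -[].
have [Q hQ eQ] := mx_in_adds (F_field HF) hM hN.
rewrite em eP -spanF_adds // -(spanF_eqmx F eQ) !dimF_span // eQ => /eqP.
rewrite subn_eq0 => le.
have PS : (P <= M + N)%MS by apply: submx_trans PM (addsmxSl _ _).
move: le; rewrite (geq_leqif (mxrank_leqif_sup PS)) addsmx_sub => /andP[MP NP].
by apply: spanF_eqmx; apply/eqmxP; rewrite (submx_trans MP PN) (submx_trans NP PM).
Qed.

End Consequences.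

(** * The continuous geometry *)

Section Doubling.
Variables (F : Cx -> Prop) (HF : conj_closed_subfield F) (n : nat).
Let e := Nat.pow 2 n.

Lemma pow2S : Nat.pow 2 n.+1 = (e + e)%N.
Proof. by rewrite /e /=; lia. Qed.

(** The halves are written as in [dup], so that [dupE] holds by conversion. *)
Definition lo_half (w : vec) : vec := fun i => if Nat.ltb i e then w i else C0.
Definition hi_half (w : vec) : vec := fun i => if Nat.ltb i e then w (e + i)%N else C0.
Definition glue (x y : vec) : vec := fun i => if Nat.ltb i e then x i else y (i - e)%N.

Lemma Cadd00 : Cadd C0 C0 = C0. Proof. by rewrite -[LHS]toCK toC_add addr0. Qed.
Lemma Cmulc0 c : Cmul c C0 = C0. Proof. by rewrite -[LHS]toCK toC_mul mulr0. Qed.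

Lemma lo_add v w : lo_half (vadd v w) = vadd (lo_half v) (lo_half w).
Proof. by apply: funext => i; rewrite /lo_half /vadd; case: Nat.ltb; rewrite ?Cadd00. Qed.

Lemma hi_add v w : hi_half (vadd v w) = vadd (hi_half v) (hi_half w).
Proof. by apply: funext => i; rewrite /hi_half /vadd; case: Nat.ltb; rewrite ?Cadd00. Qed.

Lemma lo_scale c v : lo_half (vscale c v) = vscale c (lo_half v).
Proof. by apply: funext => i; rewrite /lo_half /vscale; case: Nat.ltb; rewrite ?Cmulc0. Qed.

Lemma hi_scale c v : hi_half (vscale c v) = vscale c (hi_half v).
Proof. by apply: funext => i; rewrite /hi_half /vscale; case: Nat.ltb; rewrite ?Cmulc0. Qed.

Lemma lo_zero : lo_half vzero = vzero.
Proof. by apply: funext => i; rewrite /lo_half; case: Nat.ltb. Qed.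

Lemma hi_zero : hi_half vzero = vzero.
Proof. by apply: funext => i; rewrite /hi_half; case: Nat.ltb. Qed.

Lemma lo_glue x y : inF F e x -> lo_half (glue x y) = x.
Proof.
move=> [_ h]; apply: funext => i; rewrite /lo_half /glue.
by case: Nat.ltb_spec => // /h ->.
Qed.

Lemma hi_glue x y : inF F e y -> hi_half (glue x y) = y.
Proof.
move=> [_ h]; apply: funext => i; rewrite /hi_half /glue.
case: (Nat.ltb_spec i e) => [ie|/h -> //].
case: Nat.ltb_spec => [ie'|_]; first by lia.
by congr y; lia.
Qed.

Lemma glue_halves w : (forall i, Peano.le (Nat.pow 2 n.+1) i -> w i = C0) ->
  glue (lo_half w) (hi_half w) = w.
Proof.
move=> h; apply: funext => i; rewrite /glue /lo_half /hi_half.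
case: (Nat.ltb_spec i e) => // ie; case: (Nat.ltb_spec (i - e)%N e) => ie'.
  by congr w; lia.
by rewrite h // pow2S; lia.
Qed.

Lemma glue_add x y x' y' :
  vadd (glue x y) (glue x' y') = glue (vadd x x') (vadd y y').
Proof. by apply: funext => i; rewrite /vadd /glue; case: Nat.ltb. Qed.

Lemma glue_supp x y : inF F e x -> inF F e y ->
  forall i, Peano.le (Nat.pow 2 n.+1) i -> glue x y i = C0.
Proof.
move=> [_ hx] [_ hy] i; rewrite pow2S /glue => ie.
by case: Nat.ltb_spec => ie'; [lia|apply: hy; lia].
Qed.

Lemma dupE X w : dup n X w <->
  [/\ forall i, Peano.le (Nat.pow 2 n.+1) i -> w i = C0, X (lo_half w) & X (hi_half w)].
Proof. by split=> [[? [? ?]]|[]]. Qed.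

Lemma dup_glue X x y : subspace F e X -> X x -> X y -> dup n X (glue x y).
Proof.
move=> [XF _] hx hy; apply/dupE.
by rewrite (lo_glue _ (XF _ hx)) (hi_glue _ (XF _ hy)); split=> //; apply: glue_supp; exact: XF.
Qed.

Lemma inF_halves w : inF F (Nat.pow 2 n.+1) w <->
  [/\ forall i, Peano.le (Nat.pow 2 n.+1) i -> w i = C0, inF F e (lo_half w) & inF F e (hi_half w)].
Proof.
rewrite pow2S; split=> [[h1 h2]|[h [h1 _] [h2 _]]]; split=> //.
- split=> i ie; rewrite /lo_half; case: Nat.ltb_spec => ? //; last by lia.
    by apply: h1; lia.
  by lia.
- split=> i ie; rewrite /hi_half; case: Nat.ltb_spec => ? //; last by lia.
    by apply: h1; lia.
  by lia.
- move=> i ie; case: (Nat.ltb_spec i e) => i1.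
    by have := h1 i i1; rewrite /lo_half; case: Nat.ltb_spec => // ?; lia.
  have i2 : Peano.lt (i - e)%N e by lia.
  have := h2 _ i2; rewrite /hi_half; case: Nat.ltb_spec => [_|]; last by lia.
  by have -> : (e + (i - e))%N = i by lia.
Qed.

Lemma Csum_eq d f g : (forall i, Peano.lt i d -> f i = g i) -> Csum d f = Csum d g.
Proof.
elim: d => //= d IH h; rewrite IH; last by move=> i ?; apply: h; lia.
by rewrite h //; lia.
Qed.

Lemma Csum_split d k f : Csum (d + k)%N f = Cadd (Csum d f) (Csum k (fun i => f (d + i)%N)).
Proof.
elim: k => [|k IH]; first by rewrite addn0 -[RHS]toCK toC_add addr0 toCK.
by rewrite addnS /= IH -[LHS]toCK -[RHS]toCK !toC_add addrA.
Qed.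

Lemma inner_halves v w : inner (Nat.pow 2 n.+1) v w =
  Cadd (inner e (lo_half v) (lo_half w)) (inner e (hi_half v) (hi_half w)).
Proof.
rewrite /inner pow2S Csum_split; congr Cadd; apply: Csum_eq => i ie.
  by rewrite /lo_half; case: Nat.ltb_spec => // ?; lia.
by rewrite /hi_half; case: Nat.ltb_spec => // ?; lia.
Qed.

Lemma inner_zero_r d v : inner d v vzero = C0.
Proof. by apply/inner_eq0; rewrite torow0 adjmx0 mulmx0. Qed.

Lemma dup_subspace X : subspace F e X -> subspace F (Nat.pow 2 n.+1) (dup n X).
Proof.
move=> [XF [X0 [XD XZ]]]; split.
  by move=> w /dupE[h h1 h2]; apply/inF_halves; split=> //; exact: XF.
split; first by apply/dupE; rewrite lo_zero hi_zero.
split=> [v w /dupE[v0 v1 v2] /dupE[w0 w1 w2]|c v hc /dupE[v0 v1 v2]]; apply/dupE.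
  rewrite lo_add hi_add; split; [|exact: XD|exact: XD].
  by move=> i ie; rewrite /vadd v0 // w0 // Cadd00.
rewrite lo_scale hi_scale; split; [|exact: XZ|exact: XZ].
by move=> i ie; rewrite /vscale v0 // Cmulc0.
Qed.

Lemma dup_meet X Y : dup n (sp_meet X Y) = sp_meet (dup n X) (dup n Y).
Proof.
rewrite predeqE => w; split=> [/dupE[h [? ?] [? ?]]|[/dupE[h ? ?] /dupE[_ ? ?]]].
  by split; apply/dupE.
by apply/dupE.
Qed.

Lemma dup_join X Y : subspace F e X -> subspace F e Y ->
  dup n (sp_join X Y) = sp_join (dup n X) (dup n Y).
Proof.
move=> sX sY; have [XF _] := sX; have [YF _] := sY.
rewrite predeqE => w; split.
  move=> /dupE[h [x1 [y1 [hx1 [hy1 e1]]]] [x2 [y2 [hx2 [hy2 e2]]]]].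
  exists (glue x1 x2), (glue y1 y2); split; first exact: dup_glue.
  split; first exact: dup_glue.
  by rewrite glue_add -e1 -e2 glue_halves.
move=> [x [y [/dupE[x0 x1 x2] [/dupE[y0 y1 y2] ->]]]]; apply/dupE; split.
- by move=> i ie; rewrite /vadd x0 // y0 // Cadd00.
- by exists (lo_half x), (lo_half y); rewrite lo_add.
- by exists (hi_half x), (hi_half y); rewrite hi_add.
Qed.

Lemma dup_orth X : subspace F e X ->
  dup n (sp_orth F e X) = sp_orth F (Nat.pow 2 n.+1) (dup n X).
Proof.
move=> sX; have [XF [X0 _]] := sX; rewrite predeqE => v; split.
  move=> /dupE[h [v1 o1] [v2 o2]]; split; first exact/inF_halves.
  by move=> w /dupE[_ w1 w2]; rewrite inner_halves o1 // o2 // Cadd00.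
(* Testing [v] against [w] glued to zero, on either side, isolates each half of [v]. *)
move=> [/inF_halves[h v1 v2] o]; apply/dupE; split=> //; split=> // w hw.
  have := o _ (dup_glue sX hw X0).
  rewrite inner_halves (lo_glue _ (XF _ hw)) (hi_glue _ (XF _ X0)) inner_zero_r.
  by move=> /(congr1 toC); rewrite toC_add addr0 => /(can_inj toCK).
have := o _ (dup_glue sX X0 hw).
rewrite inner_halves (hi_glue _ (XF _ hw)) (lo_glue _ (XF _ X0)) inner_zero_r.
by move=> /(congr1 toC); rewrite toC_add add0r => /(can_inj toCK).
Qed.

Lemma dup_zero : dup n sp_zero = sp_zero.
Proof.
rewrite predeqE => w; split=> [/dupE[/glue_halves E lo0 hi0]|->].
  rewrite /sp_zero -E lo0 hi0.
  by apply: funext => i; rewrite /glue; case: Nat.ltb.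
by apply/dupE; rewrite lo_zero hi_zero.
Qed.

Lemma dup_one : dup n (sp_one F e) = sp_one F (Nat.pow 2 n.+1).
Proof. by rewrite predeqE => w; rewrite dupE /sp_one inF_halves. Qed.

End Doubling.

(** * Lifting to a common level and passing to the completion *)

Section ContinuousGeometry.
Variables (F : Cx -> Prop) (HF : conj_closed_subfield F) (HA : contains_real_algebraics F).

Lemma lift_subspace n k X : subspace F (Nat.pow 2 n) X ->
  subspace F (Nat.pow 2 (n + k)) (Defs.lift n k X).
Proof.
elim: k => [|k IH] sX; first by rewrite addn0.
by rewrite addnS; exact/dup_subspace/IH.
Qed.

Lemma lift_add n k l X : Defs.lift n (k + l)%N X = Defs.lift (n + k) l (Defs.lift n k X).
Proof. by elim: l => [|l IH]; rewrite ?addn0 // addnS /= IH; congr (dup _ _); lia. Qed.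

Lemma lift_meet n k X Y : Defs.lift n k (sp_meet X Y) = sp_meet (Defs.lift n k X) (Defs.lift n k Y).
Proof. by elim: k => //= k ->; rewrite dup_meet. Qed.

Lemma lift_join n k X Y : subspace F (Nat.pow 2 n) X -> subspace F (Nat.pow 2 n) Y ->
  Defs.lift n k (sp_join X Y) = sp_join (Defs.lift n k X) (Defs.lift n k Y).
Proof.
by move=> sX sY; elim: k => //= k ->; rewrite (dup_join (F := F)) //; exact: lift_subspace.
Qed.

Lemma lift_orth n k X : subspace F (Nat.pow 2 n) X ->
  Defs.lift n k (sp_orth F (Nat.pow 2 n) X) = sp_orth F (Nat.pow 2 (n + k)) (Defs.lift n k X).
Proof.
move=> sX; elim: k => [|k IH] /=; first by rewrite addn0.
by rewrite IH addnS dup_orth //; exact: lift_subspace.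
Qed.

Lemma lift_zero n k : Defs.lift n k sp_zero = sp_zero.
Proof. by elim: k => //= k ->; exact: dup_zero. Qed.

Lemma lift_one n k : Defs.lift n k (sp_one F (Nat.pow 2 n)) = sp_one F (Nat.pow 2 (n + k)).
Proof. by elim: k => [|k IH] /=; rewrite ?addn0 // IH addnS; exact: dup_one. Qed.

Lemma liftTo_subspace a m : Linf_elem F a -> (a.1 <= m)%N ->
  subspace F (Nat.pow 2 m) (liftTo a m).
Proof. by move=> ha am; have := lift_subspace (m - a.1) ha; rewrite subnKC. Qed.

Lemma liftTo_trans a k m : (a.1 <= k)%N -> (k <= m)%N ->
  Defs.lift k (m - k) (liftTo a k) = liftTo a m.
Proof.
move=> ak km; rewrite /liftTo.
by rewrite -{1}(subnKC ak) -lift_add; congr Defs.lift; lia.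
Qed.

Lemma level_Linf sg u : (eval_Linf F sg u).1 = level (fun i => (sg i).1) u.
Proof. by elim: u => //= [a -> b ->|a -> b ->]. Qed.

Lemma eval_Linf_elem sg u : (forall i, Linf_elem F (sg i)) -> Linf_elem F (eval_Linf F sg u).
Proof.
have le1 (a b : Linf) : (a.1 <= Nat.max a.1 b.1)%N by lia.
have le2 (a b : Linf) : (b.1 <= Nat.max a.1 b.1)%N by lia.
move=> hsg; elim: u => //= [a ha b hb|a ha b hb|a ha||].
- rewrite /Linf_elem /Linf_meet /=.
  apply: (eval_subspace HF (sg := fun i => if i is 0%N then _ else _) (tMeet (tVar 0) (tVar 1))).
  by case=> [|i]; [exact: liftTo_subspace ha (le1 _ _)|exact: liftTo_subspace hb (le2 _ _)].
- rewrite /Linf_elem /Linf_join /=.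
  apply: (eval_subspace HF (sg := fun i => if i is 0%N then _ else _) (tJoin (tVar 0) (tVar 1))).
  by case=> [|i]; [exact: liftTo_subspace ha (le1 _ _)|exact: liftTo_subspace hb (le2 _ _)].
- by apply: (eval_subspace HF (sg := fun _ => _) (tOrth (tVar 0))).
- exact: (eval_subspace HF (sg := fun _ => spanF F 0) tZero) (fun _ => spanF_subspace HF _).
- exact: (eval_subspace HF (sg := fun _ => spanF F 0) tOne) (fun _ => spanF_subspace HF _).
Qed.

(** Lifting commutes with the operations, so the varying levels used by [eval_Linf] can be replaced
    by one common level. *)
Lemma liftTo_eval sg (sg' : nat -> vec -> Prop) m u : (forall i, Linf_elem F (sg i)) ->
  (forall i, ((sg i).1 <= m)%N -> sg' i = liftTo (sg i) m) ->
  ((eval_Linf F sg u).1 <= m)%N ->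
  liftTo (eval_Linf F sg u) m = eval_sp F (Nat.pow 2 m) sg' u.
Proof.
move=> ssg hsg; elim: u => /= [i|a ha b hb|a ha b hb|a ha||].
- by move=> /hsg ->.
- move=> h; set k := Nat.max _ _ in h.
  rewrite -ha -?hb; try lia.
  rewrite {1}/liftTo /= lift_meet !liftTo_trans //; rewrite /k; lia.
- move=> h; set k := Nat.max _ _ in h.
  rewrite -ha -?hb; try lia.
  rewrite {1}/liftTo /= lift_join; first by rewrite !liftTo_trans // /k; lia.
    by apply: liftTo_subspace; [exact: eval_Linf_elem|rewrite /k; lia].
  by apply: liftTo_subspace; [exact: eval_Linf_elem|rewrite /k; lia].
- move=> h; rewrite -ha // /liftTo /= lift_orth ?subnKC //; exact: eval_Linf_elem.
- by move=> _; rewrite /liftTo lift_zero.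
- by move=> _; rewrite /liftTo (lift_one 0); congr (sp_one F (Nat.pow 2 _)) => /=; lia.
Qed.

Lemma sp_join_id d X : subspace F d X -> sp_join X X = X.
Proof.
move=> [_ [X0 [XD _]]]; rewrite predeqE => v; split.
  by move=> [x [y [hx [hy ->]]]]; exact: XD.
move=> hv; exists v, vzero; split=> //; split=> //.
by apply: funext => i; rewrite /vadd -[RHS]toCK toC_add addr0 toCK.
Qed.

Lemma sp_meet_id X : sp_meet X X = X.
Proof. by rewrite predeqE => v; split=> [[]|]. Qed.

Lemma delta_eq0 a b : Linf_elem F a -> Linf_elem F b ->
  liftTo a (Nat.max a.1 b.1) = liftTo b (Nat.max a.1 b.1) -> delta F a b = 0.
Proof.
move=> ha hb E; rewrite /delta E sp_meet_id (@sp_join_id (Nat.pow 2 (Nat.max a.1 b.1))).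
  by rewrite Nat.sub_diag /= RdivE mul0r.
by apply: liftTo_subspace => //; lia.
Qed.

Lemma delta_eq0_inv a b : Linf_elem F a -> Linf_elem F b ->
  (forall eps, Rdefinitions.Rgt eps 0 -> Rdefinitions.Rlt (delta F a b) eps) ->
  liftTo a (Nat.max a.1 b.1) = liftTo b (Nat.max a.1 b.1).
Proof.
move=> ha hb h; set k := Nat.max _ _.
apply: (dim_join_meet_eq HF (d := Nat.pow 2 k)).
- by apply: liftTo_subspace => //; rewrite /k; lia.
- by apply: liftTo_subspace => //; rewrite /k; lia.
have p0 : 0 < (Nat.pow 2 k)%:R :> R.
  by rewrite ltr0n; have := Nat.pow_nonzero 2 k; lia.
(* At level [k] the distance is a natural number divided by [2^k], so a distance below [2^-k] is
   zero. *)
have q0 : Rdefinitions.Rgt (Nat.pow 2 k)%:R^-1 0.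
  by rewrite /Rdefinitions.Rgt; apply/RltP; rewrite invr_gt0.
have := h _ q0.
rewrite /delta -/k !INRE RdivE => /RltP.
rewrite ltr_pdivrMr // mulVf ?gt_eqF // ltrn1 => dim0; lia.
Qed.

Lemma QL_N_CG s t : QL_N s t <-> valid_CG F s t.
Proof.
rewrite (QL_N_F HF HA); split=> h.
  (* The identity holds exactly at each index of the sequences, whence distance 0 from the start. *)
  move=> sg hsg _ eps eps0; exists 0%N => k _.
  set sgk := fun i => sg i k; have hk i : Linf_elem F (sgk i) by apply: hsg.
  rewrite delta_eq0 //; try exact: eval_Linf_elem.
  set m := Nat.max _ _.
  pose sg' i := if ((sgk i).1 <= m)%N then liftTo (sgk i) m else spanF F (0 : 'M[C]_(Nat.pow 2 m)).
  have hsg' i : ((sgk i).1 <= m)%N -> sg' i = liftTo (sgk i) m by rewrite /sg' => ->.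
  rewrite !(liftTo_eval (sg' := sg')) //; try (rewrite /m; lia).
  rewrite predeqE => v; apply: h => i; rewrite /sg'; case: leqP => hi.
    exact: liftTo_subspace.
  exact: spanF_subspace.
(* Conversely, constant sequences at level [d] test the identity in dimension [2^d], which is at
   least [d]. *)
move=> d; apply: (@valid_LF_le F HF d (Nat.pow 2 d)).
  by have := Nat.pow_gt_lin_r 2 d; lia.
move=> sg hsg v.
have hL i : Linf_elem F (d, sg i) by exact: hsg.
have := h (fun i _ => (d, sg i)) (fun i _ => hL i).
set sgL := fun i => (d, sg i).
have cau i : delta_Cauchy F (fun _ => sgL i).
  by move=> eps eps0; exists 0%N => p q _ _; rewrite delta_eq0 //; exact: hL.
move=> /(_ cau) {}h.
pose m := Nat.max (eval_Linf F sgL s).1 (eval_Linf F sgL t).1.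
have E : liftTo (eval_Linf F sgL s) m = liftTo (eval_Linf F sgL t) m.
  apply: delta_eq0_inv; try exact: eval_Linf_elem.
  by move=> eps /h[N /(_ N (le_n N))].
have lv u : ((eval_Linf F sgL u).1 <= d)%N.
  by rewrite level_Linf; elim: u => //= [a ? b ?|a ? b ?]; lia.
have ev u : eval_sp F (Nat.pow 2 d) sg u = liftTo (eval_Linf F sgL u) d.
  by apply/esym/liftTo_eval => // i _; rewrite /liftTo /= Nat.sub_diag.
(* Equality is known at level [m], which is at most [d]; lifting carries it to level [d]. *)
have [ls lt] := (lv s, lv t).
rewrite !ev -(@liftTo_trans (eval_Linf F sgL s) m); try (rewrite /m; lia).
by rewrite E liftTo_trans // /m; lia.
Qed.

End ContinuousGeometry.

(* Gives [<=] back its Peano meaning on [nat], as in the definitions. *)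
Import Peano.

Theorem mainTheorem4 (F : Cx -> Prop)
  (HF : conj_closed_subfield F) (HA : contains_real_algebraics F) :
  (* (1) *)
  (forall s t : term, QL_N s t <-> (forall d : nat, valid_LF F d s t)) /\
  (* (2) *)
  (forall (dn : nat -> nat) (f : nat -> (vec -> Prop) -> (vec -> Prop))
          (L : OL) (g : nat -> (vec -> Prop) -> L),
     (forall n, sp_embedding F (dn n) (dn (S n)) (f n)) ->
     (forall M, exists N, forall n, (N <= n)%nat -> (M <= dn n)%nat) ->
     is_direct_limit F dn f L g ->
     forall s t : term, QL_N s t <-> valid_OL L s t) /\
  (* (3) *)
  (forall s t : term, QL_N s t <-> valid_CG F s t).
Proof.
split; first exact: QL_N_F.
split; last exact: QL_N_CG.
move=> dn f L g f_emb dinf lim s t; apply: (QL_N_limit HF HA f_emb lim).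
by move=> M; have [N h] := dinf M; exists N => n /ssrnat.leP/h/ssrnat.leP.
Qed.
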